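(* Fix a day $d\in\mathcal D$. Suppose that the end-of-day reservoir levels are chosen one day ahead, i.e. $\bm w_{d'}\in\mathcal L^R(\mathcal F_{[\Downarrow(d')]})$ for every $d'\in\mathcal D$ (with $\bm w_0$ deterministic), so that, conditional on a fixed realization of $\bm\xi_{[\Downarrow(d)]}$, both $\bm w_{d-1}$ and $\bm w_d$ are deterministic vectors. Then, conditional on $\bm\xi_{[\Downarrow(d)]}$, the optimal value of the infinite-dimensional trader's problem (CT) equals the optimal value of the finite linear program (CT$^{\rm r}$). Both problems are defined in the context.
   Context: **Time.** Days $\mathcal D=\{1,\dots,D\}$, hours $\mathcal T=\{1,\dots,T\}$, $H=T/D\in\mathbb N$ hours per day; $t=0$ is the present. $\mathcal T(d)=\{(d-1)H+1,\dots,dH\}$ is the set of hours of day $d$; $\uparrow(d)=dH$ (last hour of day $d$), $\downarrow(d)=(d-1)H+1$ (first hour of day $d$), $\Downarrow(d)=(d-1)H$ (last hour of day $d-1$). For an hour $t$ in day $d(t)$ put $\uparrow(t)=\uparrow(d(t))$, $\downarrow(t)=\downarrow(d(t))$, $\Downarrow(t)=\Downarrow(d(t))$. **Reservoir system.** A directed acyclic graph with node (reservoir) set $\mathcal R$, $|\mathcal R|=R$, and arc set $\mathcal A$, $|\mathcal A|=A$; arcs point from upstream to downstream reservoirs. $\mathbf M\in\{-1,0,1\}^{R\times A}$ is its incidence matrix: $m_{r,a}=-1$ if arc $a$ leaves $r$, $+1$ if $a$ enters $r$, $0$ otherwise. Node $R$ is the unique sink (a dummy reservoir/river); every other node has at least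 one outgoing arc. Deterministic data for $t\in\mathcal T$: reservoir bounds $\underline{\bm w}_t\in\mathbb R_+^R$, $\overline{\bm w}_t\in(\mathbb R_+\cup\{+\infty\})^R$ with $\underline w_{t,R}=0$, $\overline w_{t,R}=+\infty$; generator and pump capacities $\overline{\bm g}_t,\overline{\bm p}_t\in\mathbb R_+^A$ (arcs entering node $R$ have no pumps, i.e. pump capacity $0$); generator efficiencies $\bm\eta_t\in\mathbb R_+^A$ and inverse pump efficiencies $\bm\zeta_t\in\mathbb R_+^A$ with $\bm\eta_t<\bm\zeta_t$ componentwise. The initial filling levels $\bm w_0\in\mathbb R^R$ are deterministic. **Uncertainty.** All random objects live on a probability space $(\Omega,\mathcal F,\mathbb P)$ and have finite expectations. For each $t\in\mathcal T$: spot price $\pi^{\rm s}_t$, capacity prices $\pi^{\rm u}_t,\pi^{\rm v}_t$ and activation prices $\psi^{\rm u}_t,\psi^{\rm v}_t$ (real-valued); inflows $\bm\phi_t\in\mathbb R_+^R$; reserve allocations $\kappa^{\rm u}_t,\kappa^{\rm v}_t$, which are Bernoulli random variables with success probabilities $\hat\kappa^{\rm u}_t=\mathbb E[\kappa^{\rm u}_t]$ and $\hat\kappa^{\rm v}_t=\mathbb E[\kappa^{\rm v}_t]$; reserve activations $\rho^{\rm u}_t,\rho^{\rm v}_t$ (fractions of hour $t$ during which up- and down-regulation is activated), which are continuous random variables with supports $[0,\overline\rho^{\rm u}_t]$ and $[0,\overline\rho^{\rm v}_t]$, the pair $(\rho^{\rm u}_t,\rho^{\rm v}_t)$ having support $\{(\rho^{\rm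 u},\rho^{\rm v})\in[0,\overline\rho^{\rm u}_t]\times[0,\overline\rho^{\rm v}_t]:\rho^{\rm u}+\rho^{\rm v}\le1\}$. The pairs $(\rho^{\rm u}_t,\rho^{\rm v}_t)$ are independent across $t$ and independent of all other random variables. The pairs $(\kappa^{\rm u}_t,\kappa^{\rm v}_t)$ are likewise independent across $t$ and independent of all other random variables. Information: $\bm\xi_t$ collects the variables revealed in hour $t\in\{0\}\cup\mathcal T$, namely: $(\psi^{\rm u}_t,\psi^{\rm v}_t,\rho^{\rm u}_t,\rho^{\rm v}_t)$ if $t\ge1$; in addition $\{(\kappa^{\rm u}_\tau,\kappa^{\rm v}_\tau)\}_{\tau=t}^{t+H-1}$ if $t$ is the first hour of a day; in addition $\{(\pi^{\rm s}_\tau,\pi^{\rm u}_\tau,\pi^{\rm v}_\tau,\bm\phi_\tau)\}_{\tau=t+1}^{t+H}$ if $t=\Downarrow(\tau')$ for some $\tau'\in\mathcal T$ (including $t=0$). $\bm\xi_{[t,t']}=(\bm\xi_t,\dots,\bm\xi_{t'})$, $\mathcal F_{[t,t']}=\sigma(\bm\xi_{[t,t']})$, $\bm\xi_{[t']}=\bm\xi_{[0,t']}$, $\mathcal F_{[t']}=\mathcal F_{[0,t']}$. $\mathcal L^k(\mathcal G)$ is the set of integrable $\mathcal G$-measurable functions $\Omega\to\mathbb R^k$, $\mathcal L=\mathcal L^1$. $\mathbb P_{|\bm\xi_{[\Downarrow(d)]}}$ is $\mathbb P$ conditioned on $\bm\xi_{[\Downarrow(d)]}$. The supremum over an empty set is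 $-\infty$. **Problem (CT)** for day $d$: $$\begin{aligned}\sup\ &\sum_{t\in\mathcal T(d)}\mathbb E\big[\pi^{\rm s}_ts_t+\kappa^{\rm u}_t(\pi^{\rm u}_t+\rho^{\rm u}_t\psi^{\rm u}_t)u_t+\kappa^{\rm v}_t(\pi^{\rm v}_t+\rho^{\rm v}_t\psi^{\rm v}_t)v_t\,\big|\,\bm\xi_{[\Downarrow(d)]}\big]\\ \text{s.t. }&s_t,u_t,v_t\in\mathbb R,\ \bm g_t,\bm p_t,\bm z_t\in\mathcal L^A(\mathcal F_{[\downarrow(d),t]})\quad\forall t\in\mathcal T(d),\end{aligned}$$ and, $\mathbb P_{|\bm\xi_{[\Downarrow(d)]}}$-a.s., for all $t\in\mathcal T(d)$: $0\le u_t$, $0\le v_t$, $\bm0\le\bm g_t\le\overline{\bm g}_t$, $\bm0\le\bm p_t\le\overline{\bm p}_t$, $\bm0\le\bm z_t$; $s_t+\kappa^{\rm u}_t\rho^{\rm u}_tu_t-\kappa^{\rm v}_t\rho^{\rm v}_tv_t=\bm\eta_t^\top\bm g_t-\bm\zeta_t^\top\bm p_t$; $\underline{\bm w}_t\le\bm w_{d-1}+\sum_{\tau=\downarrow(d)}^t[\bm\phi_\tau+\mathbf M(\bm g_\tau-\bm p_\tau+\bm z_\tau)]\le\overline{\bm w}_t$; and $\bm w_d\le\bm w_{d-1}+\sum_{\tau\in\mathcal T(d)}[\bm\phi_\tau+\mathbf M(\bm g_\tau-\bm p_\tau+\bm z_\tau)]$. **Problem (CT$^{\rm r}$)** for day $d$: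 with $\tilde\pi^{\rm s}_t=\mathbb E[\pi^{\rm s}_t|\bm\xi_{[\Downarrow(d)]}]$, $\tilde\pi^{\rm u}_t=\mathbb E[\kappa^{\rm u}_t(\pi^{\rm u}_t+\rho^{\rm u}_t\psi^{\rm u}_t)|\bm\xi_{[\Downarrow(d)]}]$, $\tilde\pi^{\rm v}_t=\mathbb E[\kappa^{\rm v}_t(\pi^{\rm v}_t+\rho^{\rm v}_t\psi^{\rm v}_t)|\bm\xi_{[\Downarrow(d)]}]$, $$\sup\ \sum_{t\in\mathcal T(d)}\tilde\pi^{\rm s}_ts_t+\tilde\pi^{\rm u}_tu_t+\tilde\pi^{\rm v}_tv_t$$ over $s_t,u_t,v_t\in\mathbb R$, $\bm g_t,\bm p_t,\bm z_t\in\mathbb R^A$, $t\in\mathcal T(d)$, subject to, for all $t\in\mathcal T(d)$: $0\le u_t$, $0\le v_t$, $\bm0\le\bm g_t\le\overline{\bm g}_t$, $\bm0\le\bm p_t\le\overline{\bm p}_t$, $\bm0\le\bm z_t$; $s_t+\overline\rho^{\rm u}_tu_t=\bm\eta_t^\top\bm g_t-\bm\zeta_t^\top\bm p_t$; $s_t-\overline\rho^{\rm v}_tv_t\ge-\bm\zeta_t^\top\overline{\bm p}_t$; $\underline{\bm w}_t\le\bm w_{d-1}+\sum_{\tau=\downarrow(d)}^t[\bm\phi_\tau+\mathbf M(\bm g_\tau-\bm p_\tau+\bm z_\tau)]\le\overline{\bm w}_t$; and $\bm w_d\le\bm w_{d-1}+\sum_{\tau\in\mathcal T(d)}[\bm\phi_\tau+\mathbf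 M(\bm g_\tau-\bm p_\tau+\bm z_\tau)]$. *)

(* Defs.v *)
From HB Require Import structures.
From mathcomp Require Import all_boot all_order all_algebra.
From mathcomp Require Import all_classical all_reals all_analysis.

Set Implicit Arguments.
Unset Strict Implicit.
Unset Printing Implicit Defensive.

Import Order.TTheory GRing.Theory Num.Theory.
Import numFieldNormedType.Exports.

Local Open Scope classical_set_scope.
Local Open Scope ring_scope.

(* Days are numbered 1, ..., D and hours 1, ..., D * H; hour 0 is the present. *)
Section time.
Variables D H : nat.

Definition is_day (d : nat) : bool := (1 <= d <= D)%N.
Definition is_hour (t : nat) : bool := (1 <= t <= D * H)%N.

Definition last_hour (d : nat) : nat := (d * H)%N.
Definition first_hour (d : nat) : nat := (d.-1 * H).+1.
Definition eve (d : nat) : nat := (d.-1 * H)%N.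

Definition day_of (t : nat) : nat := (t.-1 %/ H).+1.

Definition hours (d : nat) : pred nat :=
  [pred t | (first_hour d <= t <= last_hour d)%N].
End time.

Definition lecv (R : realType) k (x y : 'cV[R]_k) : Prop :=
  forall i, x i 0 <= y i 0.

Definition dotcv (R : realType) k (x y : 'cV[R]_k) : R := (x^T *m y) 0 0.

(* There are N.+1 reservoirs, the sink being ord_max, and A arcs; parallel arcs
   are allowed. *)
Record reservoir_system (R : realType) (N A D H : nat) := ReservoirSystem {
  src : 'I_A -> 'I_N.+1 ;
  tgt : 'I_A -> 'I_N.+1 ;
  w_min : nat -> 'cV[R]_N.+1 ;
  w_max : nat -> 'cV[\bar R]_N.+1 ;
  g_max : nat -> 'cV[R]_A ;
  p_max : nat -> 'cV[R]_A ;
  eta : nat -> 'cV[R]_A ;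
  zeta : nat -> 'cV[R]_A ;
  arcs_acyclic : forall c : seq 'I_N.+1,
    cycle (fun x y => [exists a, (src a == x) && (tgt a == y)]) c -> c = [::] ;
  sink_unique : forall r, (r == ord_max) = ~~ [exists a, src a == r] ;
  w_min_ge0 : forall t, is_hour D H t -> lecv 0 (w_min t) ;
  w_max_ge0 : forall t r, is_hour D H t -> (0 <= w_max t r 0%R)%E ;
  w_min_sink : forall t, is_hour D H t -> w_min t ord_max 0 = 0 ;
  w_max_sink : forall t, is_hour D H t -> w_max t ord_max 0 = +oo%E ;
  g_max_ge0 : forall t, is_hour D H t -> lecv 0 (g_max t) ;
  p_max_ge0 : forall t, is_hour D H t -> lecv 0 (p_max t) ;
  p_max_sink : forall t a, is_hour D H t -> tgt a = ord_max ->
    p_max t a 0 = 0 ;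
  eta_ge0 : forall t, is_hour D H t -> lecv 0 (eta t) ;
  zeta_ge0 : forall t, is_hour D H t -> lecv 0 (zeta t) ;
  eta_lt_zeta : forall t a, is_hour D H t -> eta t a 0 < zeta t a 0 }.

Definition incidence (R : realType) N A D H
    (S : reservoir_system R N A D H) : 'M[R]_(N.+1, A) :=
  \matrix_(r, a) (if src S a == r then -1 else if tgt S a == r then 1 else 0).

Section probability_notions.
Context {d : measure_display} {Omega : measurableType d} {R : realType}.
Variable P : probability Omega R.
Implicit Types (X : {RV P >-> R}) (V : set (Omega -> R)) (G : set (set Omega)).

(* The sigma-algebra generated by the random variables in V is
   <<s gen_by V >>, the sigma-algebra of g_sigma_algebraType (gen_by V). *)
Definition gen_by V : set (set Omega) :=
  \bigcup_(X in V) preimage_set_system setT X measurable.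

(* G is a generating family of the sigma-algebra in question. *)
Definition in_L G k (f : Omega -> 'cV[R]_k) : Prop :=
  forall i,
    measurable_fun [set: g_sigma_algebraType G]
      ((fun w => f w i 0) : g_sigma_algebraType G -> R) /\
    P.-integrable setT (fun w => (f w i 0)%:E).

Definition is_bernoulli X : Prop :=
  forall B, measurable B ->
    distribution P X B =
    bernoulli_prob (fine 'E_P[X]) ((fun b : bool => b%:R : R) @^-1` B).

(* S is the smallest closed set carrying the law of Y. *)
Definition has_support (T : topologicalType) (Y : Omega -> T) (S : set T) :=
  [/\ closed S, P (Y @^-1` S) = 1%E &
      forall C, closed C -> P (Y @^-1` C) = 1%E -> S `<=` C].

Definition independent2 (G1 G2 : set (set Omega)) : Prop :=
  forall A B, G1 A -> G2 B -> P (A `&` B) = (P A * P B)%E.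

Definition mutually_independent (I : pred nat) (G : nat -> set (set Omega)) :=
  forall (s : seq nat) (A : nat -> set Omega),
    uniq s -> (forall t, t \in s -> I t /\ G t (A t)) ->
    P (\bigcap_(t in [set` s]) A t) = (\prod_(t <- s) P (A t))%E.

(* K is a regular version of P conditioned on the sigma-algebra generated by G:
   K w is the conditional measure at the outcome w. That w |-> K w B is
   measurable for that sigma-algebra is part of the type of K. *)
Definition is_regular_conditional G
    (K : R.-pker (g_sigma_algebraType G) ~> Omega) : Prop :=
  forall A B, <<s G >> A -> measurable B ->
    P (A `&` B) = (\int[P]_(w in A) K w B)%E.

End probability_notions.

Record random_data d (Omega : measurableType d) (R : realType)
    (P : probability Omega R) (N : nat) := RandomData {
  pi_s : nat -> {RV P >-> R} ;
  pi_u : nat -> {RV P >-> R} ;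
  pi_v : nat -> {RV P >-> R} ;
  psi_u : nat -> {RV P >-> R} ;
  psi_v : nat -> {RV P >-> R} ;
  phi : nat -> 'I_N.+1 -> {RV P >-> R} ;
  kappa_u : nat -> {RV P >-> R} ;
  kappa_v : nat -> {RV P >-> R} ;
  rho_u : nat -> {RV P >-> R} ;
  rho_v : nat -> {RV P >-> R} ;
  rho_u_max : nat -> R ;
  rho_v_max : nat -> R }.

Section uncertainty.
Context {d : measure_display} {Omega : measurableType d} {R : realType}.
Context {P : probability Omega R} {N : nat}.
Variables (D H : nat) (X : random_data P N).

Definition inflow (t : nat) (w : Omega) : 'cV[R]_N.+1 := \col_r phi X t r w.

Definition price_inflow_vars : set (Omega -> R) :=
  [set Y : Omega -> R | exists2 t, is_hour D H t &
     Y = pi_s X t \/ Y = pi_u X t \/ Y = pi_v X t \/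
     Y = psi_u X t \/ Y = psi_v X t \/
     exists r, Y = phi X t r].

Definition kappa_pair (t : nat) : set (Omega -> R) :=
  [set Y : Omega -> R | Y = kappa_u X t \/ Y = kappa_v X t].

Definition rho_pair (t : nat) : set (Omega -> R) :=
  [set Y : Omega -> R | Y = rho_u X t \/ Y = rho_v X t].

Definition kappa_vars : set (Omega -> R) :=
  \bigcup_(t in [set t | is_hour D H t]) kappa_pair t.

Definition rho_vars : set (Omega -> R) :=
  \bigcup_(t in [set t | is_hour D H t]) rho_pair t.

(* The set of real random variables revealed in hour t. *)
Definition xi (t : nat) : set (Omega -> R) :=
  [set Y : Omega -> R | (1 <= t)%N /\ (Y = psi_u X t \/ Y = psi_v X t \/
                          Y = rho_u X t \/ Y = rho_v X t)] `|`
  [set Y : Omega -> R | ((1 <= t)%N /\ t = first_hour H (day_of H t)) /\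
     exists2 tau, (t <= tau <= t + H - 1)%N & kappa_pair tau Y] `|`
  [set Y : Omega -> R | (exists2 tau', is_hour D H tau' & t = eve H (day_of H tau')) /\
     exists2 tau, (t + 1 <= tau <= t + H)%N &
       (Y = pi_s X tau \/ Y = pi_u X tau \/ Y = pi_v X tau \/
        exists r, Y = phi X tau r)].

(* A generating family of the sigma-algebra of (xi_a, ..., xi_b). *)
Definition info (a b : nat) : set (set Omega) :=
  gen_by (\bigcup_(t in [set t | (a <= t <= b)%N]) xi t).

(* "Continuous" is read as having a continuous distribution function. *)
Record uncertainty_axioms : Prop := UncertaintyAxioms {
  finite_expectations : forall Y,
    (price_inflow_vars `|` kappa_vars `|` rho_vars) Y ->
    P.-integrable setT (EFin \o Y) ;
  inflow_ge0 : forall t r w, is_hour D H t -> 0 <= phi X t r w ;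
  kappa_bernoulli : forall t, is_hour D H t ->
    is_bernoulli (kappa_u X t) /\ is_bernoulli (kappa_v X t) ;
  rho_continuous : forall t, is_hour D H t ->
    continuous (cdf (rho_u X t)) /\ continuous (cdf (rho_v X t)) ;
  rho_u_support : forall t, is_hour D H t ->
    has_support P (rho_u X t) [set x | 0 <= x <= rho_u_max X t] ;
  rho_v_support : forall t, is_hour D H t ->
    has_support P (rho_v X t) [set x | 0 <= x <= rho_v_max X t] ;
  rho_pair_support : forall t, is_hour D H t ->
    has_support P (fun w => (rho_u X t w, rho_v X t w))
      [set x | [/\ 0 <= x.1 <= rho_u_max X t, 0 <= x.2 <= rho_v_max X t &
                   x.1 + x.2 <= 1]] ;
  rho_independent_across : mutually_independent P (is_hour D H)
    (fun t => <<s gen_by (rho_pair t) >>) ;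
  rho_independent_others : independent2 P <<s gen_by rho_vars >>
    <<s gen_by (price_inflow_vars `|` kappa_vars) >> ;
  kappa_independent_across : mutually_independent P (is_hour D H)
    (fun t => <<s gen_by (kappa_pair t) >>) ;
  kappa_independent_others : independent2 P <<s gen_by kappa_vars >>
    <<s gen_by (price_inflow_vars `|` rho_vars) >> }.

End uncertainty.

Section trader.
Context {dO : measure_display} {Omega : measurableType dO} {R : realType}.
Context {P : probability Omega R} {N A D H : nat}.
Variables (S : reservoir_system R N A D H) (X : random_data P N).
(* wlev d is the vector of reservoir levels at the end of day d. *)
Variables (wlev : nat -> Omega -> 'cV[R]_N.+1) (d : nat).
(* mu stands for P conditioned on the information at the end of day d - 1. *)
Variable mu : {measure set Omega -> \bar R}.

Definition level (w0 : 'cV[R]_N.+1) (inf : nat -> 'cV[R]_N.+1)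
    (g p z : nat -> 'cV[R]_A) (t : nat) : 'cV[R]_N.+1 :=
  w0 + \sum_(first_hour H d <= tau < t.+1)
         (inf tau + incidence S *m (g tau - p tau + z tau)).

(* The constraints common to both problems; w0 and w1 are the levels at the
   start and at the end of the day. *)
Definition operation_ok (w0 w1 : 'cV[R]_N.+1) (inf : nat -> 'cV[R]_N.+1)
    (u v : nat -> R) (g p z : nat -> 'cV[R]_A) : Prop :=
  (forall t, t \in hours H d ->
    [/\ 0 <= u t /\ 0 <= v t,
        lecv 0 (g t) /\ lecv (g t) (g_max S t),
        lecv 0 (p t) /\ lecv (p t) (p_max S t),
        lecv 0 (z t) &
        lecv (w_min S t) (level w0 inf g p z t) /\
        (forall r, ((level w0 inf g p z t r 0)%:E <= w_max S t r 0%R)%E)]) /\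
  lecv w1 (level w0 inf g p z (last_hour H d)).

Definition CT_feasible (s u v : nat -> R)
    (g p z : nat -> Omega -> 'cV[R]_A) : Prop :=
  (forall t, t \in hours H d ->
    [/\ in_L P (info D H X (first_hour H d) t) (g t),
        in_L P (info D H X (first_hour H d) t) (p t) &
        in_L P (info D H X (first_hour H d) t) (z t)]) /\
  {ae mu, forall w,
    operation_ok (wlev d.-1 w) (wlev d w) (fun t => inflow X t w) u v
      (fun t => g t w) (fun t => p t w) (fun t => z t w) /\
    forall t, t \in hours H d ->
      s t + kappa_u X t w * rho_u X t w * u t
          - kappa_v X t w * rho_v X t w * v t =
      dotcv (eta S t) (g t w) - dotcv (zeta S t) (p t w)}.

Definition CT_objective (s u v : nat -> R) : R :=
  \sum_(first_hour H d <= t < (last_hour H d).+1)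
    \int[mu]_w
      (pi_s X t w * s t
       + kappa_u X t w * (pi_u X t w + rho_u X t w * psi_u X t w) * u t
       + kappa_v X t w * (pi_v X t w + rho_v X t w * psi_v X t w) * v t).

Definition CT_value : \bar R :=
  ereal_sup [set x | exists s u v g p z,
    CT_feasible s u v g p z /\ x = (CT_objective s u v)%:E].

Definition pi_s_tilde (t : nat) : R := \int[mu]_w pi_s X t w.
Definition pi_u_tilde (t : nat) : R :=
  \int[mu]_w (kappa_u X t w * (pi_u X t w + rho_u X t w * psi_u X t w)).
Definition pi_v_tilde (t : nat) : R :=
  \int[mu]_w (kappa_v X t w * (pi_v X t w + rho_v X t w * psi_v X t w)).

(* The inflows and end-of-day levels are taken at the outcome w, which fixes
   the realization of the information at the end of day d - 1. *)
Definition CTr_feasible (w : Omega) (s u v : nat -> R)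
    (g p z : nat -> 'cV[R]_A) : Prop :=
  operation_ok (wlev d.-1 w) (wlev d w) (fun t => inflow X t w) u v g p z /\
  forall t, t \in hours H d ->
    s t + rho_u_max X t * u t =
      dotcv (eta S t) (g t) - dotcv (zeta S t) (p t) /\
    s t - rho_v_max X t * v t >= - dotcv (zeta S t) (p_max S t).

Definition CTr_objective (s u v : nat -> R) : R :=
  \sum_(first_hour H d <= t < (last_hour H d).+1)
    (pi_s_tilde t * s t + pi_u_tilde t * u t + pi_v_tilde t * v t).

Definition CTr_value (w : Omega) : \bar R :=
  ereal_sup [set x | exists s u v g p z,
    CTr_feasible w s u v g p z /\ x = (CTr_objective s u v)%:E].

End trader.

(* Main.v *)
Require Import Defs.
From HB Require Import structures.
From mathcomp Require Import all_boot all_order all_algebra.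
From mathcomp Require Import all_classical all_reals all_analysis.
From mathcomp Require Import measurable_realfun zify lra ring.

Set Implicit Arguments.
Unset Strict Implicit.
Unset Printing Implicit Defensive.

Import Order.TTheory GRing.Theory Num.Theory.
Import numFieldNormedType.Exports.

Local Open Scope classical_set_scope.
Local Open Scope ring_scope.

(** A solution of (CTr) is turned into one of (CT) by recourse: when the realized
activation asks for less energy than full up-regulation, a suitable fraction of
the generation is spilled and of the remaining pump capacity is run in a circle
with spilling.  The energy output is affine in this fraction, and all net flows,
hence all reservoir levels, are unchanged.

Conversely, let a solution of (CT) be given.  Conditionally on the information
at the end of day [d - 1], independence gives positive probability to the days
on which, in every hour, all reachable reserves are called and up-regulation is
activated within a factor [1 - e] of its maximum, down-regulation at most by a
fraction [e] of its maximum.  Freezing the decisions at one such outcome and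
absorbing the deviation in slightly smaller bids gives a feasible point of (CTr)
whose value is at most [O(e)] below.  No limit of the decisions is taken, only
one of the objective values, so no compactness is needed for the unbounded
spills.  The bound on down-regulation comes from the mirror scenario. *)

(** * Regular conditional probabilities *)

Lemma measurable_fun_finer d (T : measurableType d) d' (T' : measurableType d')
    (G : set (set T)) (f : T -> T') :
  G `<=` measurable ->
  measurable_fun [set: g_sigma_algebraType G] (f : g_sigma_algebraType G -> T') ->
  measurable_fun [set: T] f.
Proof.
move=> Gm mf _ B mB; have := mf measurableT B mB.
by rewrite !setTI; apply: smallest_sub Gm _; exact: sigma_algebra_measurable.
Qed.

Section regular_conditional.
Context {d : measure_display} {Omega : measurableType d} {R : realType}.
Variables (P : probability Omega R) (G : set (set Omega)).
Variable K : R.-pker (g_sigma_algebraType G) ~> Omega.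
Hypothesis Gm : G `<=` measurable.
Hypothesis K_cond : is_regular_conditional P K.

Let sGm : <<s G >> `<=` @measurable _ Omega.
Proof. by apply: smallest_sub Gm; exact: sigma_algebra_measurable. Qed.

Let measurable_cond (B : set Omega) : measurable B ->
  measurable_fun [set: Omega] ((fun w => K w B) : Omega -> \bar R).
Proof. by move=> mB; apply: (measurable_fun_finer Gm); exact: measurable_kernel. Qed.

(** A nonnegative function whose integral over [A] is zero vanishes almost everywhere on [A]; here
    it is the conditional probability of [B]. *)
Let cond_ae0 (A B : set Omega) : <<s G >> A -> measurable B ->
  P (A `&` B) = 0 -> {ae P, forall w : Omega, A w -> K w B = 0}.
Proof.
move=> GA mB; rewrite K_cond// => i0.
have mA := sGm GA.
have /ae_eq_integral_abs : measurable_fun A ((fun w => K w B) : Omega -> \bar R).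
  by apply: measurable_funTS; exact: measurable_cond.
move=> /(_ P mA)[+ _].
rewrite -[X in X = 0 -> _]/(\int[P]_(x in A) `|K x B|)%E.
under eq_integral do rewrite gee0_abs//.
by move=> /(_ i0); apply: filterS => w /= + Aw => /(_ Aw).
Qed.

Lemma regular_conditional_ae (Q : Omega -> Prop) :
  {ae P, forall w : Omega, Q w} -> {ae P, forall w : Omega, {ae K w, forall w', Q w'}}.
Proof.
move=> [B [mB PB0 QB]].
have : {ae P, forall w : Omega, [set: Omega] w -> K w B = 0}.
  by apply: cond_ae0; rewrite ?setTI//; exact: (@measurableT _ (g_sigma_algebraType G)).
by apply: filterS => w /(_ I) KB0; exists B.
Qed.

Lemma regular_conditional_sub (A : set Omega) : <<s G >> A ->
  {ae P, forall w : Omega, A w -> {ae K w, forall w', A w'}}.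
Proof.
move=> GA; have mA := sGm GA.
have := cond_ae0 GA (measurableC mA); rewrite setICr measure0 => /(_ erefl).
apply: filterS => w /[apply] KA0.
by exists (~` A); split => //; exact: measurableC.
Qed.

(** For rational q, the events Y <= q and Y >= q lie in the conditioning sigma-algebra, hence have
    full conditional measure almost everywhere on themselves. Countably many such thresholds pin
    down the value of [Y]. *)
Lemma regular_conditional_const (Y : Omega -> R) :
  measurable_fun [set: g_sigma_algebraType G] (Y : g_sigma_algebraType G -> R) ->
  {ae P, forall w : Omega, {ae K w, forall w', Y w' = Y w}}.
Proof.
move=> mY.
(* An enumeration of the rationals; the default 0 for codes that decode to nothing merely repeats a
   threshold. *)
pose q n : R := if unpickle n is Some q then ratr q else 0.
have preimG (I : interval R) : <<s G >> (Y @^-1` [set` I]).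
  rewrite -[X in <<s _>> X]setTI.
  by apply: mY; [exact: (@measurableT _ (g_sigma_algebraType G))|exact: measurable_itv].
have le_q : {ae P, forall w : Omega, forall n, Y w <= q n ->
    {ae K w, forall w', Y w' <= q n}}.
  apply: ae_foralln => n.
  have := regular_conditional_sub (preimG `]-oo, q n]).
  apply: filterS => w /= h Yq.
  have /h : Y w \in `]-oo, q n] by rewrite in_itv.
  by apply: filterS => w' /=; rewrite in_itv.
have ge_q : {ae P, forall w : Omega, forall n, q n <= Y w ->
    {ae K w, forall w', q n <= Y w'}}.
  apply: ae_foralln => n.
  have := regular_conditional_sub (preimG `[q n, +oo[).
  apply: filterS => w /= h Yq.
  have /h : Y w \in `[q n, +oo[ by rewrite in_itv/= andbT.
  by apply: filterS => w' /=; rewrite in_itv/= andbT.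
move: le_q ge_q; apply: filterS2 => w le_q ge_q.
have le_q' : {ae K w, forall w', forall n, Y w <= q n -> Y w' <= q n}.
  apply: ae_foralln => n; have [Yq|Yq] := leP (Y w) (q n).
    by have := le_q n Yq; apply: filterS.
  by apply: aeW.
have ge_q' : {ae K w, forall w', forall n, q n <= Y w -> q n <= Y w'}.
  apply: ae_foralln => n; have [Yq|Yq] := leP (q n) (Y w).
    by have := ge_q n Yq; apply: filterS.
  by apply: aeW.
move: le_q' ge_q'; apply: filterS2 => w' le_q' ge_q'.
apply/eqP; rewrite eq_le; apply/andP; split; rewrite leNgt; apply/negP.
- move=> /rat_in_itvoo[r]; rewrite in_itv/= => /andP[r1 r2].
  have := le_q' (pickle r); rewrite /q pickleK => /(_ (ltW r1)).
  by rewrite leNgt r2.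
- move=> /rat_in_itvoo[r]; rewrite in_itv/= => /andP[r1 r2].
  have := ge_q' (pickle r); rewrite /q pickleK => /(_ (ltW r2)).
  by rewrite leNgt r1.
Qed.

(** The set where [K w E] vanishes belongs to the conditioning sigma-algebra. Its intersection with
    [E] is null by conditioning and has product probability by independence, so the set itself is
    null. *)
Lemma regular_conditional_gt0 (E : set Omega) : measurable E ->
  (forall A, <<s G >> A -> P (A `&` E) = (P A * P E)%E) -> (0 < P E)%E ->
  {ae P, forall w : Omega, (0 < K w E)%E}.
Proof.
move=> mE indE PE.
pose A := (fun w : Omega => K w E) @^-1` [set 0%E].
have GA : <<s G >> A.
  rewrite -[X in <<s _>> X]setTI.
  have /= mK := measurable_kernel K E mE.
  by apply: mK; [exact: (@measurableT _ (g_sigma_algebraType G))|exact: emeasurable_set1].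
exists A; split; first exact: sGm.
  have : P (A `&` E) = 0.
    rewrite K_cond//; apply: integral0_eq => w; exact.
  rewrite indE// => /eqP; rewrite mule_eq0 => /orP[/eqP//|/eqP PE0].
  by rewrite PE0 ltxx in PE.
by move=> w /= /negP; rewrite -leNgt measure_le0 => /eqP.
Qed.

Import HBNNSimple.

Let integral_cond_nnsfun (f : {nnsfun Omega >-> R}) :
  (\int[P]_w (f w)%:E = \int[P]_w \int[K w]_w' (f w')%:E)%E.
Proof.
have int_sum (mu : {measure set Omega -> \bar R}) :
    (\int[mu]_w (f w)%:E = \sum_(r \in range f) r%:E * mu (f @^-1` [set r]))%E.
  by rewrite integralT_nnsfun sintegralE.
rewrite int_sum.
under [RHS]eq_integral do rewrite int_sum.
have r0 (r : R) : (range f) r -> 0 <= r by move=> [w _ <-].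
rewrite ge0_integral_fsum//.
- apply: eq_fsbigr => r; rewrite inE => /r0 rge0.
  rewrite ge0_integralZl//; last exact: measurable_cond.
  congr (_ * _)%E.
  have := K_cond (@measurableT _ (g_sigma_algebraType G))
    (measurable_sfunP f (measurable_set1 r)).
  by rewrite setTI.
- move=> r; apply: measurable_funeM; exact: measurable_cond.
(* The finite sum formally runs over all reals, so negative values have to be dismissed: their
   fibres are empty. *)
- move=> r w _; have [rge0|rlt0] := leP 0 r; first by rewrite mule_ge0.
  suff -> : f @^-1` [set r] = set0 by rewrite measure0 mule0.
  apply/seteqP; split=> // w' /= fr.
  by move: rlt0; rewrite -fr ltNge => /negP; apply.
Qed.

(** The tower rule, by monotone convergence for [P], for each [K w], and for the resulting sequence
    of conditional integrals. *)
Lemma regular_conditional_ge0_integral (f : Omega -> \bar R) :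
  (forall w, 0 <= f w)%E -> measurable_fun setT f ->
  (\int[P]_w f w = \int[P]_w \int[K w]_w' f w')%E.
Proof.
move=> f0 mf; pose f_ := nnsfun_approx measurableT mf.
have mf_ n : measurable_fun setT (fun w => (f_ n w)%:E) by exact/measurable_EFinP.
have f_0 n w : [set: Omega] w -> (0 <= (f_ n w)%:E)%E by rewrite lee_fin.
have ndf_ w : [set: Omega] w -> nondecreasing_seq (fun n => (f_ n w)%:E).
  by move=> _ a b ab; rewrite lee_fin; exact/lefP/nd_nnsfun_approx.
have mcf (mu : {measure set Omega -> \bar R}) :
    (\int[mu]_w f w = lim (\int[mu]_w (f_ n w)%:E @[n --> \oo]))%E.
  rewrite -monotone_convergence//.
  by apply/eq_integral => z _; apply/esym/cvg_lim => //=; exact: cvg_nnsfun_approx.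
rewrite mcf; under [RHS]eq_integral do rewrite mcf.
rewrite monotone_convergence//.
- by apply/congr_lim/funext => n; exact: integral_cond_nnsfun.
- move=> n; apply: (measurable_fun_integral_kernel _ _ (mf_ n)) => //.
  by move=> w; rewrite lee_fin.
- by move=> n w _; apply: integral_ge0 => w' _; rewrite lee_fin.
- move=> w _ a b ab; apply: ge0_le_integral => //.
    by move=> z _; rewrite lee_fin.
  by move=> z _; rewrite lee_fin; exact/lefP/nd_nnsfun_approx.
Qed.

(** By the tower rule the conditional integrals of the absolute value have a finite mean, so almost
    all of them are finite. *)
Lemma regular_conditional_integrable (Y : Omega -> R) :
  P.-integrable setT (EFin \o Y) ->
  {ae P, forall w : Omega, (K w).-integrable setT (EFin \o Y)}.
Proof.
move=> /integrableP[mY intY].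
have mK : measurable_fun [set: Omega] (fun w : Omega => \int[K w]_w' `|(Y w')%:E|)%E.
  apply: (measurable_fun_finer Gm).
  apply: measurable_fun_integral_kernel => //; last exact: measurableT_comp.
  by move=> U mU; exact: measurable_kernel.
have : P.-integrable setT (fun w => \int[K w]_w' `|(Y w')%:E|)%E.
  apply/integrableP; split => //.
  under eq_integral do rewrite gee0_abs ?integral_ge0//.
  rewrite -regular_conditional_ge0_integral//; last exact: measurableT_comp.
move=> /(integrable_ae measurableT); apply: filterS => w /(_ I) fin.
by apply/integrableP; split => //; rewrite -ge0_fin_numE// integral_ge0.
Qed.

End regular_conditional.

(** * Sigma-algebras generated by families of random variables *)

Section generated.
Context {d : measure_display} {Omega : measurableType d} {R : realType}.
Implicit Types (V : set (Omega -> R)) (G : set (set Omega)).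

Lemma gen_byP V (A : set Omega) :
  gen_by V A <-> exists2 Y, V Y & exists2 B, measurable B & A = Y @^-1` B.
Proof.
split=> [[Y VY [B mB <-]]|[Y VY [B mB ->]]].
  by exists Y => //; exists B; rewrite ?setTI.
by exists Y => //; exists B; rewrite ?setTI.
Qed.

Lemma g_sigma_mono G1 G2 : G1 `<=` <<s G2 >> -> <<s G1 >> `<=` <<s G2 >>.
Proof. by apply: smallest_sub; exact: smallest_sigma_algebra. Qed.

Lemma gen_by_mono V1 V2 : V1 `<=` V2 -> <<s gen_by V1 >> `<=` <<s gen_by V2 >>.
Proof.
move=> V12; apply: g_sigma_mono => A [Y VY YA].
by apply: sub_sigma_algebra; exists Y => //; exact: V12.
Qed.

Lemma gen_by_measurable V : (forall Y, V Y -> measurable_fun setT Y) ->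
  gen_by V `<=` measurable.
Proof. by move=> mV A [Y /mV mY [B mB <-]]; exact: mY. Qed.

Lemma gen_by_sub_measurable V : (forall Y, V Y -> measurable_fun setT Y) ->
  <<s gen_by V >> `<=` measurable.
Proof.
move=> /gen_by_measurable; apply: smallest_sub.
exact: sigma_algebra_measurable.
Qed.

Lemma measurable_gen_by V Y : V Y ->
  measurable_fun [set: g_sigma_algebraType (gen_by V)]
    (Y : g_sigma_algebraType (gen_by V) -> R).
Proof.
by move=> VY _ B mB; apply: sub_sigma_algebra; exists Y => //; exists B.
Qed.

Lemma gen_by_preimage V Y B : V Y -> measurable B -> <<s gen_by V >> (Y @^-1` B).
Proof.
by move=> VY mB; apply: sub_sigma_algebra; apply/gen_byP; exists Y => //; exists B.
Qed.

Lemma g_sigma_setT G : <<s G >> [set: Omega].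
Proof. exact: (@measurableT _ (g_sigma_algebraType G)). Qed.

Lemma g_sigma_setI G A B : <<s G >> A -> <<s G >> B -> <<s G >> (A `&` B).
Proof. exact: (@measurableI _ (g_sigma_algebraType G)). Qed.

Lemma g_sigma_bigcap G (s : seq nat) (A : nat -> set Omega) :
  (forall t, t \in s -> <<s G >> (A t)) ->
  <<s G >> (\bigcap_(t in [set` s]) A t).
Proof.
move=> GA; apply: (@fin_bigcap_measurable _ (g_sigma_algebraType G)) => //.
Qed.

End generated.

(** * Independence of future reserves from the past *)

Section independence.
Context {d : measure_display} {Omega : measurableType d} {R : realType}.
Context {P : probability Omega R} {N : nat}.
Variables (D H : nat) (X : random_data P N).
Hypothesis X_ok : uncertainty_axioms D H X.

Lemma random_data_measurable Y :
  (price_inflow_vars D H X `|` kappa_vars D H X `|` rho_vars D H X) Y ->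
  measurable_fun setT Y.
Proof.
move=> /(finite_expectations X_ok) /integrableP[/measurable_EFinP mY _].
exact: mY.
Qed.

Let allhours := iota 1 (D * H).

Let mem_allhours t : (t \in allhours) = is_hour D H t.
Proof. by rewrite mem_iota add1n ltnS. Qed.

(* The rectangles B * prod_t C_t * prod_t Q_t, cut out by the prices and
   inflows, the allocations and the activations. *)
Definition rect (B : set Omega) (C Q : nat -> set Omega) : set Omega :=
  B `&` (\bigcap_(t in [set` allhours]) C t)
    `&` \bigcap_(t in [set` allhours]) Q t.

Definition rect_ok (B : set Omega) (C Q : nat -> set Omega) : Prop :=
  [/\ <<s gen_by (price_inflow_vars D H X) >> B,
      forall t, <<s gen_by (kappa_pair X t) >> (C t) &
      forall t, <<s gen_by (rho_pair X t) >> (Q t)].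

Lemma rect_setI B1 C1 Q1 B2 C2 Q2 :
  rect B1 C1 Q1 `&` rect B2 C2 Q2 =
  rect (B1 `&` B2) (fun t => C1 t `&` C2 t) (fun t => Q1 t `&` Q2 t).
Proof. by rewrite /rect !bigcapI setIACA; congr (_ `&` _); rewrite setIACA. Qed.

Lemma rect_ok_setI B1 C1 Q1 B2 C2 Q2 :
  rect_ok B1 C1 Q1 -> rect_ok B2 C2 Q2 ->
  rect_ok (B1 `&` B2) (fun t => C1 t `&` C2 t) (fun t => Q1 t `&` Q2 t).
Proof.
move=> [B1ok C1ok Q1ok] [B2ok C2ok Q2ok]; split=> [|t|t]; exact: g_sigma_setI.
Qed.

(** The activations are split off first, then the allocations, and each of the two intersections
    factorizes across hours. *)
Lemma probability_rect B C Q : rect_ok B C Q ->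
  P (rect B C Q) =
  (P B * (\prod_(t <- allhours) P (C t)) * \prod_(t <- allhours) P (Q t))%E.
Proof.
move=> [Bok Cok Qok].
have kappaC t : is_hour D H t -> <<s gen_by (kappa_vars D H X) >> (C t).
  move=> ht; apply: gen_by_mono (Cok t) => Y Yt; exact: bigcup_sup Yt.
have rhoQ t : is_hour D H t -> <<s gen_by (rho_vars D H X) >> (Q t).
  move=> ht; apply: gen_by_mono (Qok t) => Y Yt; exact: bigcup_sup Yt.
have kC : <<s gen_by (kappa_vars D H X) >> (\bigcap_(t in [set` allhours]) C t).
  by apply: g_sigma_bigcap => t; rewrite mem_allhours; exact: kappaC.
have rQ : <<s gen_by (rho_vars D H X) >> (\bigcap_(t in [set` allhours]) Q t).
  by apply: g_sigma_bigcap => t; rewrite mem_allhours; exact: rhoQ.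
rewrite /rect setIC (rho_independent_others X_ok)//; last first.
  apply: g_sigma_setI; first by apply: gen_by_mono Bok => Y ?; left.
  by apply: gen_by_mono kC => Y ?; right.
rewrite setIC (kappa_independent_others X_ok)//; last first.
  by apply: gen_by_mono Bok => Y ?; left.
rewrite (rho_independent_across X_ok) ?iota_uniq//; last first.
  by move=> t; rewrite mem_allhours.
rewrite (kappa_independent_across X_ok) ?iota_uniq//; last first.
  by move=> t; rewrite mem_allhours.
by rewrite muleC [X in (X * _)%E]muleC.
Qed.

Lemma rect_ok_measurable B C Q : rect_ok B C Q -> measurable (rect B C Q).
Proof.
move=> [Bok Cok Qok]; apply: measurableI; first apply: measurableI.
- apply: (gen_by_sub_measurable _ Bok) => Y HY; apply: random_data_measurable.
  by left; left.
- apply: fin_bigcap_measurable => // t; rewrite /= mem_allhours => ht.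
  apply: (gen_by_sub_measurable _ (Cok t)) => Y HY.
  by apply: random_data_measurable; left; right; exists t.
- apply: fin_bigcap_measurable => // t; rewrite /= mem_allhours => ht.
  apply: (gen_by_sub_measurable _ (Qok t)) => Y HY.
  by apply: random_data_measurable; right; exists t.
Qed.

(** A pi-system that carries the information up to [t0]. Only reserves are cut off at [t0]: prices
    and inflows of all hours may enter, being independent of every reserve. *)
Definition past_rects (t0 : nat) : set (set Omega) :=
  [set A | exists B C Q, [/\ A = rect B C Q, rect_ok B C Q &
    forall t, (t0 < t)%N -> C t = setT /\ Q t = setT]].

Lemma past_rects_setI t0 : setI_closed (past_rects t0).
Proof.
move=> _ _ [B1 [C1 [Q1 [-> ok1 T1]]]] [B2 [C2 [Q2 [-> ok2 T2]]]].
exists (B1 `&` B2), (fun t => C1 t `&` C2 t), (fun t => Q1 t `&` Q2 t).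
split; [exact: rect_setI|exact: rect_ok_setI|move=> t t0t].
by have [-> ->] := T1 _ t0t; have [-> ->] := T2 _ t0t; rewrite setTI.
Qed.

(** With E the future rectangle, the finite measures sending A to P(A and E) and to P(E) P(A) agree
    on the pi-system, hence on the sigma-algebra it generates. *)
Lemma past_rects_independent t0 C Q :
  rect_ok setT C Q -> (forall t, (t <= t0)%N -> C t = setT /\ Q t = setT) ->
  forall A, <<s past_rects t0 >> A ->
    P (A `&` rect setT C Q) = (P A * P (rect setT C Q))%E.
Proof.
move=> okE TE; have mE := rect_ok_measurable okE; set E := rect setT C Q.
have PE : P E = (fine (P E))%:E by rewrite fineK// fin_num_measure.
have E0 : 0 <= fine (P E) by rewrite fine_ge0.
move=> A sA; rewrite PE muleC.
apply: (@g_sigma_algebra_measure_unique _ R Omega (past_rects t0) _ (fun=> setT)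
  _ _ (mrestr P mE) (mscale (NngNum E0) P)) => //.
- by move=> _ [B [C' [Q' [-> ok _]]]]; exact: rect_ok_measurable.
- move=> _; exists setT, (fun=> setT), (fun=> setT); split => //.
    by apply/seteqP; split => w //= _; split.
  by split=> *; exact: g_sigma_setT.
- by rewrite bigcup_const//; exists 0%N.
- exact: past_rects_setI.
- move=> _ [B [C' [Q' [-> ok T']]]].
  rewrite -[LHS]/(P (rect B C' Q' `&` rect setT C Q)).
  rewrite -[RHS]/((fine (P E))%:E * P (rect B C' Q'))%E -PE rect_setI /E.
  rewrite !probability_rect//; last first.
    exact: rect_ok_setI.
  rewrite probability_setT mul1e setIT.
  (* In every hour one of the two rectangles is unconstrained, so no independence within an hour is
     used. *)
  have prodM (F G : nat -> set Omega) :
      (forall t, F t = setT \/ G t = setT) ->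
      (\prod_(t <- allhours) P (F t `&` G t) =
       (\prod_(t <- allhours) P (F t)) * \prod_(t <- allhours) P (G t))%E.
    move=> FG; rewrite -big_split/=; apply: eq_bigr => t _.
    by case: (FG t) => ->; rewrite ?setTI ?setIT probability_setT ?mul1e ?mule1.
  rewrite !prodM.
  + by rewrite (muleA (P B)) muleACA [LHS]muleC.
  + by move=> t; have [/TE[]|/T'[]] := leqP t t0; auto.
  + by move=> t; have [/TE[]|/T'[]] := leqP t t0; auto.
- move=> _; apply: le_lt_trans (ltry 1%R).
  exact: (probability_le1 P (measurableI _ _ measurableT mE)).
Qed.

End independence.

(** * Events of one day and the information on its eve *)

Section day_events.
Context {dO : measure_display} {Omega : measurableType dO} {R : realType}.
Context {P : probability Omega R} {N : nat}.
Variables (D H : nat) (X : random_data P N).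
Hypothesis X_ok : uncertainty_axioms D H X.
Hypothesis H_gt0 : (0 < H)%N.
Variable d : nat.
Hypothesis d_day : is_day D d.

Lemma hours_gt_eve t : t \in hours H d -> (eve H d < t)%N.
Proof. by rewrite inE => /andP[]. Qed.

Lemma hours_is_hour t : t \in hours H d -> is_hour D H t.
Proof.
rewrite inE /first_hour /last_hour /is_hour => /andP[t1 t2].
rewrite (leq_ltn_trans _ t1)//= (leq_trans t2)//.
by rewrite leq_mul2r; move: d_day => /andP[_ ->]; rewrite orbT.
Qed.

Lemma eve_le_horizon : (eve H d <= D * H)%N.
Proof.
rewrite /eve leq_mul2r; move: d_day => /andP[d1 dD].
by rewrite (leq_trans (leq_pred d))// orbT.
Qed.

Let rect_price (B : set Omega) : rect D H B (fun=> setT) (fun=> setT) = B.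
Proof.
by apply/seteqP; split => [w [[]]//|w Bw]; split=> // t.
Qed.

Let one (tau : nat) (A : set Omega) (t : nat) := if t == tau then A else setT.

Let rect_kappa tau (A : set Omega) : is_hour D H tau ->
  rect D H setT (one tau A) (fun=> setT) = A.
Proof.
move=> htau; apply/seteqP; split => [w [[_ Aw] _]|w Aw].
  have := Aw tau; rewrite /one eqxx; apply.
  by rewrite /= mem_iota add1n ltnS.
by split => //; split => // t _; rewrite /one; case: ifP.
Qed.

Let rect_rho tau (A : set Omega) : is_hour D H tau ->
  rect D H setT (fun=> setT) (one tau A) = A.
Proof.
move=> htau; apply/seteqP; split => [w [_ Aw]|w Aw].
  have := Aw tau; rewrite /one eqxx; apply.
  by rewrite /= mem_iota add1n ltnS.
by split => // t _; rewrite /one; case: ifP.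
Qed.

Let past_price t0 Y B : price_inflow_vars D H X Y -> measurable B ->
  past_rects D H X t0 (Y @^-1` B).
Proof.
move=> XY mB; exists (Y @^-1` B), (fun=> setT), (fun=> setT).
split => //; split => *; [exact: gen_by_preimage|exact: g_sigma_setT..].
Qed.

Let past_kappa t0 tau Y B : is_hour D H tau -> (tau <= t0)%N ->
  kappa_pair X tau Y -> measurable B -> past_rects D H X t0 (Y @^-1` B).
Proof.
move=> htau taut0 XY mB; exists setT, (one tau (Y @^-1` B)), (fun=> setT).
split => [|| t t0t]; first by rewrite rect_kappa.
- split=> [|t|t]; try exact: g_sigma_setT.
  rewrite /one; case: eqP => [->|_]; last exact: g_sigma_setT.
  exact: gen_by_preimage.
- by rewrite /one; case: eqP => // tt; move: t0t; rewrite tt ltnNge taut0.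
Qed.

Let past_rho t0 tau Y B : is_hour D H tau -> (tau <= t0)%N ->
  rho_pair X tau Y -> measurable B -> past_rects D H X t0 (Y @^-1` B).
Proof.
move=> htau taut0 XY mB; exists setT, (fun=> setT), (one tau (Y @^-1` B)).
split => [|| t t0t]; first by rewrite rect_rho.
- split=> [|t|t]; try exact: g_sigma_setT.
  rewrite /one; case: eqP => [->|_]; last exact: g_sigma_setT.
  exact: gen_by_preimage.
- by rewrite /one; case: eqP => // tt; move: t0t; rewrite tt ltnNge taut0.
Qed.

Lemma info_past_rects : info D H X 0 (eve H d) `<=` past_rects D H X (eve H d).
Proof.
move=> _ /gen_byP[Y [t /= t_eve XY] [B mB ->]].
have t_hour : (1 <= t)%N -> is_hour D H t.
  by move=> t1; rewrite /is_hour t1 (leq_trans t_eve)// eve_le_horizon.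
case: XY => [[[t1 XY]|[[t1 tE] [tau /andP[ttau tauH] XY]]]|].
- case: XY => [|[|[|]]] YE.
  + by apply: past_price => //; exists t; [exact: t_hour|tauto].
  + by apply: past_price => //; exists t; [exact: t_hour|tauto].
  + by apply: (@past_rho _ t) => //; [exact: t_hour|left].
  + by apply: (@past_rho _ t) => //; [exact: t_hour|right].
(* Allocations are announced for a whole day; a day that has begun by the eve of [d] also ends by
   then, because the eve closes a day. *)
- have tau_eve : (tau <= eve H d)%N.
    move: tauH t_eve; rewrite tE /first_hour /day_of /eve /=.
    set q := (t.-1 %/ H)%N => tauH qd.
    have qd1 : (q < d.-1)%N by rewrite -(ltn_pmul2r H_gt0).
    apply: (@leq_trans (q.+1 * H)); last by rewrite leq_mul2r qd1 orbT.
    by apply: leq_trans tauH _; rewrite mulSn; lia.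
  apply: (@past_kappa _ tau) => //.
  by rewrite /is_hour (leq_trans t1 ttau) (leq_trans tau_eve)// eve_le_horizon.
(* The announced prices and inflows may belong to day [d] itself; it is enough that their hour lies
   within the horizon. *)
- move=> [[tau' /andP[t1' tD'] tE] [tau /andP[ttau tauH] XY]].
  have htau : is_hour D H tau.
    rewrite /is_hour (leq_trans _ ttau) ?addn1//=; apply: leq_trans tauH _.
    rewrite tE /eve /day_of /= -mulSnr leq_mul2r; apply/orP; right.
    by rewrite ltn_divLR// -ltnS prednK.
  apply: past_price => //; exists tau => //.
  by move: XY => [|[|[|]]]; tauto.
Qed.

Definition day_event (C Q : nat -> set Omega) : set Omega :=
  [set w | forall t, t \in hours H d -> C t w /\ Q t w].

(** Padding with the full set outside day [d] turns a day event into a rectangle. *)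
Let off (C : nat -> set Omega) (t : nat) : set Omega :=
  if t \in hours H d then C t else setT.

Let day_eventE C Q : day_event C Q = rect D H setT (off C) (off Q).
Proof.
apply/seteqP; split=> w.
  by move=> E; split; [split=> //|]; move=> t _; rewrite /off; case: ifPn => // /E[].
move=> [[_ Cw] Qw] t td.
have tD : t \in iota 1 (D * H) by rewrite mem_iota add1n ltnS; exact: hours_is_hour.
by have := Cw t tD; have := Qw t tD; rewrite /off td.
Qed.

Section fixed_day_event.
Variables (C Q : nat -> set Omega).
Hypothesis Cok : forall t, t \in hours H d ->
  <<s gen_by (kappa_pair X t) >> (C t) /\ (0 < P (C t))%E.
Hypothesis Qok : forall t, t \in hours H d ->
  <<s gen_by (rho_pair X t) >> (Q t) /\ (0 < P (Q t))%E.

Let off_ok : rect_ok D H X setT (off C) (off Q).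
Proof.
split => [|t|t]; first exact: g_sigma_setT.
- rewrite /off; case: ifPn => [/Cok[]//|_]; exact: g_sigma_setT.
- rewrite /off; case: ifPn => [/Qok[]//|_]; exact: g_sigma_setT.
Qed.

Lemma day_event_measurable : measurable (day_event C Q).
Proof. by rewrite day_eventE; exact: (rect_ok_measurable X_ok). Qed.

Lemma day_event_gt0 : (0 < P (day_event C Q))%E.
Proof.
rewrite day_eventE (probability_rect X_ok)// probability_setT mul1e.
apply: mule_gt0; (elim/big_ind: _ => //= [x y|t _]; first exact: mule_gt0).
- by rewrite /off; case: ifPn => [/Cok[]//|_]; rewrite probability_setT.
- by rewrite /off; case: ifPn => [/Qok[]//|_]; rewrite probability_setT.
Qed.

Lemma day_event_independent A : <<s info D H X 0 (eve H d) >> A ->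
  P (A `&` day_event C Q) = (P A * P (day_event C Q))%E.
Proof.
move=> GA; rewrite day_eventE; apply: (past_rects_independent X_ok off_ok).
  move=> t te; rewrite /off; case: ifPn => // /hours_gt_eve.
  by rewrite ltnNge te.
apply: g_sigma_mono GA => B /info_past_rects; exact: sub_sigma_algebra.
Qed.

End fixed_day_event.
End day_events.

(** * Supports and Bernoulli variables *)

Section almost_sure.
Context {d : measure_display} {Omega : measurableType d} {R : realType}.
Variable P : probability Omega R.

Lemma probability1_ae (A : set Omega) : measurable A -> P A = 1%E ->
  {ae P, forall w, A w}.
Proof.
move=> mA PA; exists (~` A); split => //; first exact: measurableC.
by rewrite probability_setC// PA subee.
Qed.

Lemma has_support_ae (T : topologicalType) (Y : Omega -> T) (S : set T) :
  measurable (Y @^-1` S) -> has_support P Y S -> {ae P, forall w, S (Y w)}.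
Proof. by move=> mS [_ PS _]; exact: probability1_ae. Qed.

(** If the open set were null, its complement would be closed of full measure and so contain the
    support, including [y]. *)
Lemma has_support_open (T : topologicalType) (Y : Omega -> T) (S O : set T) y :
  has_support P Y S -> open O -> measurable (Y @^-1` O) -> S y -> O y ->
  (0 < P (Y @^-1` O))%E.
Proof.
move=> [_ _ minS] oO mO Sy Oy; rewrite lt0e measure_ge0 andbT; apply/eqP => PO.
apply: (minS (~` O) _ _ y) => //; first exact: open_closedC.
by rewrite preimage_setC probability_setC// PO sube0.
Qed.

Lemma has_support_itv_ge0 (Y : {RV P >-> R}) (a : R) :
  has_support P Y [set x | 0 <= x <= a] -> 0 <= a.
Proof.
move=> [_ P1 _]; rewrite leNgt; apply/negP => a0; move: P1.
rewrite (_ : _ @^-1` _ = set0) ?measure0 => [/eqP|].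
  by rewrite eq_sym onee_eq0.
by apply/seteqP; split=> // w /= /andP[Y0 Ya]; have := le_trans Y0 Ya; rewrite leNgt a0.
Qed.

(** With [a] = 0 the variable would vanish almost surely, and its distribution function would jump
    from 0 to 1 at the origin. *)
Lemma has_support_itv_gt0 (Y : {RV P >-> R}) (a : R) :
  continuous (cdf Y) -> has_support P Y [set x | 0 <= x <= a] -> 0 < a.
Proof.
move=> cY supY; have := has_support_itv_ge0 supY.
rewrite le_eqVlt => /predU1P[a0|//]; exfalso.
have [_ P1 _] := supY.
have P0 : P (Y @^-1` [set 0]) = 1%E.
  rewrite -P1; congr (P _); apply/seteqP; split=> w /=.
    by rewrite -a0 => ->; rewrite lexx.
  by rewrite -a0 => /le_anti.
have m0 : measurable (Y @^-1` [set 0]).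
  by rewrite -[X in measurable X]setTI; exact: measurable_funPT.
have cdf0 : cdf Y 0 = 1%E.
  apply/eqP; rewrite eq_le cdf_le1/= /cdf/distribution/pushforward -P0.
  by apply: le_measure; rewrite ?inE//; [
    rewrite -[X in measurable X]setTI; exact: measurable_funPT
  | move=> w /= ->; rewrite in_itv/=].
have cdfN x : x < 0 -> cdf Y x = 0%E.
  move=> x0; apply/eqP; rewrite eq_le cdf_ge0 andbT.
  have <- : P (~` (Y @^-1` [set 0])) = 0%E by rewrite probability_setC// P0 subee.
  rewrite /cdf/distribution/pushforward; apply: le_measure; rewrite ?inE//.
  - by rewrite -[X in measurable X]setTI; exact: measurable_funPT.
  - exact: measurableC.
  - by move=> w /=; rewrite in_itv/= => + Y0; rewrite Y0 leNgt x0.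
have o : nbhs (cdf Y 0) [set y | (0 < y)%E].
  by apply: open_nbhs_nbhs; split; [exact: open_ereal_gt_ereal|rewrite cdf0/= lte01].
(* Continuity at 0 is tested at -e/2, within distance e on the left, where the distribution function
   is still 0. *)
have [e /= e0 /(_ (- (e / 2)))] := cY 0 _ o.
rewrite /ball/= sub0r opprK ger0_norm ?divr_ge0 ?ltW// => /(_ _)/wrap[].
  by rewrite ltr_pdivrMr// ltr_pMr// ltr1n.
by rewrite cdfN ?ltxx// oppr_lt0 divr_gt0.
Qed.

(* The largest value that a Bernoulli variable takes with positive probability. *)
Definition reachable (Y : Omega -> R) : R :=
  ((0 < P (Y @^-1` [set 1%R]))%E : bool)%:R.

Lemma reachable01 (Y : Omega -> R) : 0 <= reachable Y <= 1.
Proof. by rewrite /reachable ler0n lern1; case: (_ < _)%E. Qed.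

Lemma bernoulli_01 (Y : {RV P >-> R}) : is_bernoulli Y ->
  P (Y @^-1` [set 0; 1]) = 1%E.
Proof.
move=> bY; have := bY [set 0; 1].
rewrite /distribution/pushforward => ->; last exact: measurableU.
rewrite (_ : _ @^-1` _ = setT) ?probability_setT//.
by apply/seteqP; split => // -[] _ /=; [right|left].
Qed.

Let mpre (Y : {RV P >-> R}) (A : set R) : measurable A -> measurable (Y @^-1` A).
Proof. by move=> mA; rewrite -[X in measurable X]setTI; exact: measurable_funPT. Qed.

(** The equation encodes that a variable which cannot reach 1 is almost surely 0; it later allows
    bids on unreachable reserves to be dropped. *)
Lemma bernoulli_ae (Y : {RV P >-> R}) : is_bernoulli Y ->
  {ae P, forall w, 0 <= Y w <= 1 /\ Y w * reachable Y = Y w}.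
Proof.
move=> bY; have ae01 : {ae P, forall w, Y w = 0 \/ Y w = 1}.
  by apply: probability1_ae (bernoulli_01 bY); apply: mpre; exact: measurableU.
rewrite /reachable; case: ltP => [_|].
  by move: ae01; apply: filterS => w [] ->; rewrite mulr1 lexx ler01.
rewrite measure_le0 => /eqP P1.
have ae1 : {ae P, forall w, Y w <> 1}.
  by exists (Y @^-1` [set 1]); split => [||w /= /contrapT]//; exact: mpre.
by move: ae01 ae1; apply: filterS2 => w [] -> // _; rewrite mul0r lexx ler01.
Qed.

Lemma bernoulli_reachable (Y : {RV P >-> R}) : is_bernoulli Y ->
  (0 < P (Y @^-1` [set reachable Y]))%E.
Proof.
move=> bY; rewrite /reachable; case: (ltP 0%E (P (Y @^-1` [set 1%R]))) => [//|].
rewrite measure_le0 => /eqP P1.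
have := bernoulli_01 bY; rewrite preimage_setU measureU; first last.
- by apply/seteqP; split=> // w /= [->] /eqP; rewrite eq_sym oner_eq0.
- exact: mpre.
- exact: mpre.
by rewrite P1 adde0 => ->; rewrite lte01.
Qed.

End almost_sure.

(** * Extreme activations have positive probability *)

Section activations.
Context {d : measure_display} {Omega : measurableType d} {R : realType}.
Context {P : probability Omega R}.
Variables (Yu Yv : {RV P >-> R}) (a b : R).
Hypothesis sup_u : has_support P Yu [set x | 0 <= x <= a].
Hypothesis sup_v : has_support P Yv [set x | 0 <= x <= b].
Hypothesis sup_uv : has_support P (fun w => (Yu w, Yv w))
  [set x | [/\ 0 <= x.1 <= a, 0 <= x.2 <= b & x.1 + x.2 <= 1]].

Let mpre (Y : {RV P >-> R}) (A : set R) : measurable A -> measurable (Y @^-1` A).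
Proof. by move=> mA; rewrite -[X in measurable X]setTI; exact: measurable_funPT. Qed.

Let mitv (Y : {RV P >-> R}) (I : interval R) : measurable (Y @^-1` [set` I]).
Proof. by apply: mpre; exact: measurable_itv. Qed.

(** The joint support gives Y <= 1 almost surely, and this closed condition passes to the whole
    marginal support. It is what places the corners (a, 0) and (0, b) in the joint support. *)
Let le1 (Y : {RV P >-> R}) (c : R) :
  has_support P Y [set x | 0 <= x <= c] ->
  (forall w, 0 <= Yu w -> 0 <= Yv w -> Yu w + Yv w <= 1 -> Y w <= 1) -> c <= 1.
Proof.
move=> supY SY; have c0 := has_support_itv_ge0 supY; have [_ _ minS] := supY.
suff : [set x | 0 <= x <= c] `<=` [set x | x <= 1].
  by apply; rewrite /= c0 lexx.
apply: minS; first exact: closed_le.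
have mY1 : measurable (Y @^-1` [set x | x <= 1]).
  by have := mitv Y `]-oo, 1]; rewrite set_itvNyc.
apply/eqP; rewrite eq_le probability_le1//=.
have [_ <- _] := sup_uv.
apply: le_measure; rewrite ?inE//; last by move=> w [/andP[? _] /andP[? _]]; exact: SY.
rewrite (_ : _ @^-1` _ = Yu @^-1` [set` `[0, a]] `&` Yv @^-1` [set` `[0, b]] `&`
    (Yu \+ Yv) @^-1` [set` `]-oo, 1]]); last first.
  apply/seteqP; split => w /=; rewrite !in_itv/= => -[].
    by move=> -> -> ->.
  by move=> [-> ->] ->.
apply: measurableI; first by apply: measurableI; exact: mitv.
rewrite -[X in measurable X]setTI.
by apply: measurable_funD => //; exact: measurable_itv.
Qed.

(** The event is the preimage of an open neighbourhood of the support point (a, 0). *)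
Lemma activation_up_gt0 a' b' : a' < a -> 0 < b' ->
  (0 < P (Yu @^-1` [set` `]a', +oo[] `&` Yv @^-1` [set` `]-oo, b'[]))%E.
Proof.
move=> a'a b'0.
have a0 := has_support_itv_ge0 sup_u; have b0 := has_support_itv_ge0 sup_v.
have a1 : a <= 1 by apply: (le1 sup_u) => w _ ? ?; lra.
rewrite -[X in P X]/((fun w => (Yu w, Yv w)) @^-1`
   (fst @^-1` [set` `]a', +oo[] `&` snd @^-1` [set` `]-oo, b'[])).
apply: (has_support_open (y := (a, 0)) sup_uv).
- by apply: openI; apply: open_comp => //= x _; [exact: cvg_fst|exact: cvg_snd].
- by apply: measurableI; exact: mitv.
- by split => //=; rewrite ?a0 ?b0 ?lexx ?addr0.
- by split => /=; rewrite in_itv/= ?a'a ?b'0.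
Qed.

Lemma activation_down_gt0 a' b' : 0 < a' -> b' < b ->
  (0 < P (Yu @^-1` [set` `]-oo, a'[] `&` Yv @^-1` [set` `]b', +oo[]))%E.
Proof.
move=> a'0 b'b.
have a0 := has_support_itv_ge0 sup_u; have b0 := has_support_itv_ge0 sup_v.
have b1 : b <= 1 by apply: (le1 sup_v) => w ? _ ?; lra.
rewrite -[X in P X]/((fun w => (Yu w, Yv w)) @^-1`
   (fst @^-1` [set` `]-oo, a'[] `&` snd @^-1` [set` `]b', +oo[])).
apply: (has_support_open (y := (0, b)) sup_uv).
- by apply: openI; apply: open_comp => //= x _; [exact: cvg_fst|exact: cvg_snd].
- by apply: measurableI; exact: mitv.
- by split => //=; rewrite ?a0 ?b0 ?lexx ?add0r.
- by split => /=; rewrite in_itv/= ?a'0 ?b'b.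
Qed.

End activations.

(** * Almost-everywhere comparison of integrals *)

Section ae_integrable.
Context {d : measure_display} {T : measurableType d} {R : realType}.
Variable mu : {measure set T -> \bar R}.

Lemma ae_le_integrable (f g : T -> R) : measurable_fun setT f ->
  mu.-integrable setT (EFin \o g) -> {ae mu, forall x, `|f x| <= g x} ->
  mu.-integrable setT (EFin \o f).
Proof.
move=> mf /integrable_abse /integrableP[mg intg] fg.
have mf' : measurable_fun setT (EFin \o f) by exact/measurable_EFinP.
apply/integrableP; split => //.
apply: le_lt_trans intg; apply: ae_ge0_le_integral => //.
- exact: measurableT_comp.
- exact: measurableT_comp.
- apply: filterS fg => x + _; rewrite lee_fin => fg.
  by rewrite [leRHS]ger0_norm ?normr_ge0// (le_trans fg)// ler_norm.
Qed.

Lemma ae_eq_Rintegral (f g : T -> R) : measurable_fun setT f ->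
  measurable_fun setT g -> {ae mu, forall x, f x = g x} ->
  \int[mu]_x f x = \int[mu]_x g x.
Proof.
move=> mf mg fg; rewrite /Rintegral; congr fine.
apply: ae_eq_integral => //; [exact/measurable_EFinP..|].
by apply: filterS fg => x ->.
Qed.

End ae_integrable.

(** * Almost every outcome is good *)

Section good_outcomes.
Context {dO : measure_display} {Omega : measurableType dO} {R : realType}.
Context {P : probability Omega R} {N : nat}.
Variables (D H : nat) (X : random_data P N).
Variables (wlev : nat -> Omega -> 'cV[R]_N.+1) (d : nat).

Definition plausible (t : nat) (w : Omega) : Prop :=
  [/\ 0 <= kappa_u X t w <= 1 /\
        kappa_u X t w * reachable P (kappa_u X t) = kappa_u X t w,
      0 <= kappa_v X t w <= 1 /\
        kappa_v X t w * reachable P (kappa_v X t) = kappa_v X t w,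
      0 <= rho_u X t w <= rho_u_max X t &
      0 <= rho_v X t w <= rho_v_max X t].

Definition revealed_as (w w' : Omega) : Prop :=
  [/\ wlev d.-1 w' = wlev d.-1 w, wlev d w' = wlev d w &
      forall t, t \in hours H d -> inflow X t w' = inflow X t w].

(* Up to the precision e, the day on which every reachable up-regulation is
   activated in full. *)
Definition up_day (e : R) : set Omega :=
  day_event H d (fun t => kappa_u X t @^-1` [set reachable P (kappa_u X t)])
    (fun t => rho_u X t @^-1` [set` `](1 - e) * rho_u_max X t, +oo[] `&`
              rho_v X t @^-1` [set` `]-oo, e * rho_v_max X t[]).

Definition down_day (e : R) : set Omega :=
  day_event H d (fun t => kappa_v X t @^-1` [set reachable P (kappa_v X t)])
    (fun t => rho_u X t @^-1` [set` `]-oo, e * rho_u_max X t[] `&`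
              rho_v X t @^-1` [set` `](1 - e) * rho_v_max X t, +oo[]).

(** A consequence of positive measure, in the form in which it is used: an outcome of [E] can be
    picked that satisfies any given almost sure constraints. *)
Definition meets (mu : {measure set Omega -> \bar R}) (E : set Omega) : Prop :=
  forall Q : Omega -> Prop, {ae mu, forall w, Q w} -> exists2 w, E w & Q w.

(** Gathers all that is needed of the conditional measure, so that the two problems can afterwards
    be compared for one fixed [mu] and [w]. Precisions 1/(n+1) keep the number of exceptional null
    sets countable. *)
Record good_outcome (mu : {measure set Omega -> \bar R}) (w : Omega) : Prop :=
  GoodOutcome {
  good_plausible :
    {ae mu, forall w', forall t, t \in hours H d -> plausible t w'} ;
  good_revealed : {ae mu, forall w', revealed_as w w'} ;
  good_integrable : forall t, t \in hours H d ->
    [/\ mu.-integrable setT (EFin \o pi_s X t),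
        mu.-integrable setT (EFin \o (fun w' => kappa_u X t w' *
          (pi_u X t w' + rho_u X t w' * psi_u X t w'))) &
        mu.-integrable setT (EFin \o (fun w' => kappa_v X t w' *
          (pi_v X t w' + rho_v X t w' * psi_v X t w')))] ;
  good_reachable : forall t, t \in hours H d ->
    pi_u_tilde X mu t * reachable P (kappa_u X t) = pi_u_tilde X mu t /\
    pi_v_tilde X mu t * reachable P (kappa_v X t) = pi_v_tilde X mu t ;
  good_up : forall n, meets mu (up_day n.+1%:R^-1) ;
  good_down : forall n, meets mu (down_day n.+1%:R^-1) }.

Hypothesis X_ok : uncertainty_axioms D H X.
Hypothesis H_gt0 : (0 < H)%N.
Variable w0 : 'cV[R]_N.+1.
Hypothesis wlev0 : forall w, wlev 0%N w = w0.
Hypothesis wlev_ahead : forall d', is_day D d' ->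
  in_L P (info D H X 0 (eve H d')) (wlev d').
Hypothesis d_day : is_day D d.

Let is_hour_day t : t \in hours H d -> is_hour D H t.
Proof. exact: hours_is_hour. Qed.

Lemma plausible_ae :
  {ae P, forall w : Omega, forall t, t \in hours H d -> plausible t w}.
Proof.
apply: ae_foralln => t.
have [/is_hour_day ht|_] := boolP (t \in hours H d); last exact: aeW.
have mset (Y : {RV P >-> R}) a : measurable (Y @^-1` [set x | 0 <= x <= a]).
  have := measurable_funPT Y measurableT _ (measurable_itv `[0, a]).
  by rewrite setTI set_itvcc.
have [bu bv] := kappa_bernoulli X_ok ht.
have au := bernoulli_ae bu; have av := bernoulli_ae bv.
have ru := has_support_ae (mset _ _) (rho_u_support X_ok ht).
have rv := has_support_ae (mset _ _) (rho_v_support X_ok ht).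
by apply: filterS2 (filterI au av) (filterI ru rv) => w [? ?] [? ?] _.
Qed.

Lemma eve_info_measurable : info D H X 0 (eve H d) `<=` @measurable _ Omega.
Proof.
move=> A /(info_past_rects H_gt0 d_day)[B [C [Q [-> ok _]]]].
exact: rect_ok_measurable ok.
Qed.

Lemma info_mono a a' b b' : (a' <= a)%N -> (b <= b')%N ->
  <<s info D H X a b >> `<=` <<s info D H X a' b' >>.
Proof.
move=> aa bb; apply: gen_by_mono => Y [t /= /andP[at_ tb] XY].
by exists t => //=; rewrite (leq_trans aa)//= (leq_trans tb).
Qed.

Lemma measurable_info_mono a a' b b' (Y : Omega -> R) :
  (a' <= a)%N -> (b <= b')%N ->
  measurable_fun [set: g_sigma_algebraType (info D H X a b)]
    (Y : g_sigma_algebraType (info D H X a b) -> R) ->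
  measurable_fun [set: g_sigma_algebraType (info D H X a' b')]
    (Y : g_sigma_algebraType (info D H X a' b') -> R).
Proof.
by move=> aa bb mY _ B mB; apply: (info_mono aa bb); exact: mY.
Qed.

Lemma wlev_eve_measurable (r : 'I_N.+1) (d' : nat) : d' = d \/ d' = d.-1 ->
  measurable_fun [set: g_sigma_algebraType (info D H X 0 (eve H d))]
    ((fun w => wlev d' w r 0) : g_sigma_algebraType (info D H X 0 (eve H d)) -> R).
Proof.
move=> [->|->]; first by have [] := wlev_ahead d_day r.
(* On the first day the starting level is the deterministic [w0], as the measurability assumption
   only concerns days from 1 on. *)
have [d0|d0] := posnP d.-1.
  rewrite d0; apply: (eq_measurable_fun (cst (w0 r 0))) => [w _|]; last exact: measurable_cst.
  by rewrite wlev0.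
have d1_day : is_day D d.-1.
  by move: d_day => /andP[_ dD]; rewrite /is_day d0 (leq_trans (leq_pred d)).
have [m _] := wlev_ahead d1_day r.
by apply: measurable_info_mono m => //; rewrite /eve leq_mul2r leq_pred orbT.
Qed.

Lemma inflow_eve_measurable (r : 'I_N.+1) t : t \in hours H d ->
  measurable_fun [set: g_sigma_algebraType (info D H X 0 (eve H d))]
    (phi X t r : g_sigma_algebraType (info D H X 0 (eve H d)) -> R).
Proof.
move=> td; apply: measurable_gen_by; exists (eve H d) => //=.
have dE : d.-1.+1 = d by case: d d_day.
move: td; rewrite inE => /andP[td1 td2].
right; split; last first.
  exists t; last by right; right; right; exists r.
  by rewrite addn1 -/(first_hour H d) td1 /eve -mulSnr dE.
(* An hour whose eve is the current one has to be exhibited; the first hour of day [d] serves. *)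
exists (first_hour H d); last by rewrite /eve /day_of /first_hour /= mulnK.
apply: is_hour_day; rewrite inE leqnn/= /first_hour /last_hour -{2}dE mulSnr.
by rewrite -addn1 leq_add2l.
Qed.

Variable K : R.-pker (g_sigma_algebraType (info D H X 0 (eve H d))) ~> Omega.
Hypothesis K_cond : is_regular_conditional P K.

Let Gm := eve_info_measurable.

Lemma revealed_as_ae : {ae P, forall w : Omega, {ae K w, forall w', revealed_as w w'}}.
Proof.
have vec (f : Omega -> 'cV[R]_N.+1) : (forall r,
    measurable_fun [set: g_sigma_algebraType (info D H X 0 (eve H d))]
      ((fun w => f w r 0) : g_sigma_algebraType (info D H X 0 (eve H d)) -> R)) ->
    {ae P, forall w : Omega, {ae K w, forall w', f w' = f w}}.
  move=> mf.
  (* [inord] maps the naturals onto the finitely many coordinates, so the countable intersection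
     rule applies. *)
  have : {ae P, forall w : Omega, forall n,
      {ae K w, forall w', f w' (inord n) 0 = f w (inord n) 0}}.
    by apply: ae_foralln => n; exact: (regular_conditional_const Gm K_cond (mf _)).
  apply: filterS => w /ae_foralln; apply: filterS => w' fE.
  by apply/matrixP => r j; rewrite !ord1 -(inord_val r).
have inf : {ae P, forall w : Omega, forall t, {ae K w, forall w',
    t \in hours H d -> inflow X t w' = inflow X t w}}.
  apply: ae_foralln => t; have [td|_] := boolP (t \in hours H d).
    apply: filterS (vec (inflow X t) _) => [w|r].
      by apply: filterS => w' ->.
    apply: eq_measurable_fun (inflow_eve_measurable r td) => w _.
    by rewrite mxE.
  by apply: aeW => w; exact: aeW.
have := vec (wlev d.-1) (fun r => wlev_eve_measurable r (or_intror erefl)).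
have := vec (wlev d) (fun r => wlev_eve_measurable r (or_introl erefl)).
move=> h1 h2; apply: filterS3 inf h1 h2 => w /ae_foralln i1 i2 i3.
by apply: filterS3 i1 i2 i3 => w' ? ? ?.
Qed.

(** Since [k] lies in [0, 1] and [r] in [0, c], the revenue is dominated by |p| + c |ps|. *)
Lemma regulation_integrable (k p r ps : {RV P >-> R}) (c : R) :
  P.-integrable setT (EFin \o p) -> P.-integrable setT (EFin \o ps) ->
  {ae P, forall w : Omega, 0 <= k w <= 1 /\ 0 <= r w <= c} ->
  P.-integrable setT (EFin \o (fun w => k w * (p w + r w * ps w))).
Proof.
move=> ip ips box.
apply: (@ae_le_integrable _ _ _ P _ (fun w => `|p w| + c * `|ps w|)).
- apply: measurable_funM => //; apply: measurable_funD => //.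
  exact: measurable_funM.
- rewrite (_ : _ \o _ = (fun w => (`|p w|)%:E + c%:E * (`|ps w|)%:E)%E)//.
  apply: integrableD => //; first exact: (integrable_abse ip).
  by apply: integrableZl => //; exact: (integrable_abse ips).
- apply: filterS box => w [/andP[k0 k1] /andP[r0 rc]].
  rewrite normrM (ger0_norm k0).
  have n0 : 0 <= `|p w + r w * ps w| by [].
  apply: le_trans (ler_piMl n0 k1) _.
  apply: le_trans (ler_normD _ _) _; rewrite lerD2l normrM (ger0_norm r0).
  by rewrite ler_wpM2r.
Qed.

Lemma revenue_integrable t : t \in hours H d ->
  [/\ P.-integrable setT (EFin \o pi_s X t),
      P.-integrable setT (EFin \o (fun w' => kappa_u X t w' *
        (pi_u X t w' + rho_u X t w' * psi_u X t w'))) &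
      P.-integrable setT (EFin \o (fun w' => kappa_v X t w' *
        (pi_v X t w' + rho_v X t w' * psi_v X t w')))].
Proof.
move=> td; have ht := is_hour_day td.
have int_price Y : price_inflow_vars D H X Y -> P.-integrable setT (EFin \o Y).
  by move=> HY; apply: (finite_expectations X_ok); left; left.
split.
- by apply: int_price; exists t => //; left.
- apply: (regulation_integrable (c := rho_u_max X t)).
  + by apply: int_price; exists t => //; tauto.
  + by apply: int_price; exists t => //; tauto.
  + by apply: filterS plausible_ae => w /(_ t td)[[? _] _ ? _].
- apply: (regulation_integrable (c := rho_v_max X t)).
  + by apply: int_price; exists t => //; tauto.
  + by apply: int_price; exists t => //; tauto.
  + by apply: filterS plausible_ae => w /(_ t td)[_ [? _] _ ?].
Qed.

(** The day event is independent of the eve information and has positive probability, so almost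
    every conditional measure charges it; it then cannot lie inside a null set. *)
Let day_ae C Q :
  (forall t, t \in hours H d ->
     <<s gen_by (kappa_pair X t) >> (C t) /\ (0 < P (C t))%E) ->
  (forall t, t \in hours H d ->
     <<s gen_by (rho_pair X t) >> (Q t) /\ (0 < P (Q t))%E) ->
  {ae P, forall w : Omega, meets (K w) (day_event H d C Q)}.
Proof.
move=> Cok Qok; have mE := day_event_measurable X_ok d_day Cok Qok.
have : {ae P, forall w : Omega, (0 < K w (day_event H d C Q))%E}; last first.
  apply: filterS => w KE Q' [B [mB KB0 QB]]; apply: contrapT => noQ.
  move: KE; rewrite ltNge -KB0 => /negP; apply; apply: le_measure; rewrite ?inE//.
  by move=> w' Ew'; apply: QB => /= Qw'; apply: noQ; exists w'.
apply: (regular_conditional_gt0 Gm K_cond) => //.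
- exact: (day_event_independent X_ok H_gt0 d_day Cok Qok).
- exact: (day_event_gt0 X_ok d_day Cok Qok).
Qed.

Lemma up_day_ae : {ae P, forall w : Omega, forall n, meets (K w) (up_day n.+1%:R^-1)}.
Proof.
apply: ae_foralln => n; set e : R := n.+1%:R^-1.
have e0 : 0 < e by rewrite invr_gt0.
apply: day_ae => t td; have ht := is_hour_day td.
  split; first by apply: gen_by_preimage => //; left.
  by apply: bernoulli_reachable; case: (kappa_bernoulli X_ok ht).
have [cu cv] := rho_continuous X_ok ht.
have su := rho_u_support X_ok ht; have sv := rho_v_support X_ok ht.
(* Positive maxima make both thresholds of the scenario strict: (1 - e) times the maximum is below
   it, and e times the maximum is above 0. *)
have ru0 := has_support_itv_gt0 cu su; have rv0 := has_support_itv_gt0 cv sv.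
split; first by apply: g_sigma_setI; apply: gen_by_preimage => //; [left|right].
apply: (activation_up_gt0 su sv (rho_pair_support X_ok ht)); last exact: mulr_gt0.
by rewrite gtr_pMl// gtrDl oppr_lt0.
Qed.

Lemma down_day_ae : {ae P, forall w : Omega, forall n, meets (K w) (down_day n.+1%:R^-1)}.
Proof.
apply: ae_foralln => n; set e : R := n.+1%:R^-1.
have e0 : 0 < e by rewrite invr_gt0.
apply: day_ae => t td; have ht := is_hour_day td.
  split; first by apply: gen_by_preimage => //; right.
  by apply: bernoulli_reachable; case: (kappa_bernoulli X_ok ht).
have [cu cv] := rho_continuous X_ok ht.
have su := rho_u_support X_ok ht; have sv := rho_v_support X_ok ht.
have ru0 := has_support_itv_gt0 cu su; have rv0 := has_support_itv_gt0 cv sv.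
split; first by apply: g_sigma_setI; apply: gen_by_preimage => //; [left|right].
apply: (activation_down_gt0 su sv (rho_pair_support X_ok ht)); first exact: mulr_gt0.
by rewrite gtr_pMl// gtrDl oppr_lt0.
Qed.

Lemma good_outcome_ae : {ae P, forall w : Omega, good_outcome (K w) w}.
Proof.
have plaus := regular_conditional_ae Gm K_cond plausible_ae.
have int : {ae P, forall w : Omega, forall t, t \in hours H d ->
    [/\ (K w).-integrable setT (EFin \o pi_s X t),
        (K w).-integrable setT (EFin \o (fun w' => kappa_u X t w' *
          (pi_u X t w' + rho_u X t w' * psi_u X t w'))) &
        (K w).-integrable setT (EFin \o (fun w' => kappa_v X t w' *
          (pi_v X t w' + rho_v X t w' * psi_v X t w')))]}.
  apply: ae_foralln => t; have [td|_] := boolP (t \in hours H d); last exact: aeW.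
  have [i1 i2 i3] := revenue_integrable td.
  have j1 := regular_conditional_integrable Gm K_cond i1.
  have j2 := regular_conditional_integrable Gm K_cond i2.
  have j3 := regular_conditional_integrable Gm K_cond i3.
  by apply: filterS3 j1 j2 j3 => w ? ? ? _.
apply: filterS3 (filterI plaus int) revealed_as_ae (filterI up_day_ae down_day_ae).
move=> w [pl i] rev [up down]; split=> // t td.
have [_ iu iv] := i t td; rewrite /pi_u_tilde /pi_v_tilde.
(* The revenue contains the allocation as a factor, hence is almost surely unchanged when multiplied
   by its reachable value. *)
have rE (f : Omega -> R) c : (K w).-integrable setT (EFin \o f) ->
    {ae K w, forall w', f w' * c = f w'} ->
    \int[K w]_w' f w' * c = \int[K w]_w' f w'.
  move=> intf fc; rewrite -RintegralZr//.
  have mf : measurable_fun setT f by case/integrableP: intf => /measurable_EFinP.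
  by apply: ae_eq_Rintegral => //; exact: measurable_funM.
split; apply: rE => //; apply: filterS pl => w' /(_ t td)[[_ ku] [_ kv] _ _].
  by rewrite mulrAC ku.
by rewrite mulrAC kv.
Qed.

End good_outcomes.

(** * Dot products, a limit argument and affine decisions *)

Section dot_product.
Context {R : realType} {k : nat}.
Implicit Types x y z : 'cV[R]_k.

Lemma dotcvDr x y z : dotcv x (y + z) = dotcv x y + dotcv x z.
Proof. by rewrite /dotcv mulmxDr mxE. Qed.

Lemma dotcvZr x (c : R) y : dotcv x (c *: y) = c * dotcv x y.
Proof. by rewrite /dotcv -scalemxAr mxE. Qed.

Lemma dotcvNr x y : dotcv x (- y) = - dotcv x y.
Proof. by rewrite /dotcv mulmxN mxE. Qed.

Lemma dotcv_le x y z : lecv 0 x -> lecv y z -> dotcv x y <= dotcv x z.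
Proof.
move=> x0 yz; rewrite /dotcv !mxE; apply: ler_sum => i _.
by rewrite ler_wpM2l// mxE; have := x0 i; rewrite mxE.
Qed.

Lemma dotcv_ge0 x y : lecv 0 x -> lecv 0 y -> 0 <= dotcv x y.
Proof.
by move=> x0 /(dotcv_le x0); rewrite /dotcv mulmx0 mxE.
Qed.

End dot_product.

Lemma le_of_harmonic (R : realType) (a b c : R) :
  (forall n : nat, a <= b + n.+1%:R^-1 * c) -> a <= b.
Proof.
move=> abc; apply/ler_addgt0Pr => e e0.
have n0 : 0 < (Num.bound (`|c| / e)).+1%:R :> R by [].
apply: le_trans (abc (Num.bound (`|c| / e))) _; rewrite lerD2l.
rewrite mulrC ler_pdivrMr// (le_trans (ler_norm c))// mulrC -ler_pdivrMr//.
apply: ltW.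
apply: lt_le_trans (archi_boundP _) _; first by rewrite divr_ge0 ?normr_ge0 ?ltW.
by rewrite ler_nat.
Qed.

Lemma in_L_affine d (Omega : measurableType d) (R : realType)
    (P : probability Omega R) (G : set (set Omega)) k (lam : Omega -> R)
    (a b : 'cV[R]_k) :
  measurable_fun [set: g_sigma_algebraType G] (lam : g_sigma_algebraType G -> R) ->
  P.-integrable setT (EFin \o lam) ->
  in_L P G (fun w => a + lam w *: b).
Proof.
move=> mlam ilam i.
have E w : (a + lam w *: b) i 0 = a i 0 + lam w * b i 0 by rewrite !mxE.
split.
  rewrite (_ : (fun w => _) = (fun w => a i 0 + lam w * b i 0)); last exact/funext.
  by apply: measurable_funD => //; exact: measurable_funM.
rewrite (_ : (fun w => _) = (fun w => (a i 0)%:E + (lam w)%:E * (b i 0)%:E)%E).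
  apply: integrableD => //; first exact: finite_measure_integrable_cst.
  exact: integrableZr.
by apply/funext => w; rewrite E.
Qed.

(** * Objectives, reservoir levels and energy output *)

Section trader_problem.
Context {dO : measure_display} {Omega : measurableType dO} {R : realType}.
Context {P : probability Omega R} {N A D H : nat}.
Variables (S : reservoir_system R N A D H) (X : random_data P N).
Variables (wlev : nat -> Omega -> 'cV[R]_N.+1) (d : nat).
Variables (mu : {measure set Omega -> \bar R}) (w : Omega).
Hypothesis good : good_outcome H X wlev d mu w.
Hypothesis H_gt0 : (0 < H)%N.
Hypothesis d_day : is_day D d.

Let hoursE t : (t \in hours H d) = (first_hour H d <= t < (last_hour H d).+1)%N.
Proof. by rewrite inE ltnS. Qed.

Let last_in : last_hour H d \in hours H d.
Proof.
have dE : d.-1.+1 = d by case: d d_day.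
rewrite inE leqnn andbT /first_hour /last_hour -{2}dE mulSnr.
by rewrite -addn1 leq_add2l.
Qed.

(** The bids are deterministic, so they leave the conditional expectations by linearity. *)
Lemma CT_objectiveE (s u v : nat -> R) :
  CT_objective (H := H) X d mu s u v = CTr_objective (H := H) X d mu s u v.
Proof.
rewrite /CT_objective /CTr_objective; apply: eq_big_nat => t; rewrite -hoursE => td.
have [is_ iu iv] := good_integrable good td.
have iZ (f : Omega -> R) c : mu.-integrable setT (EFin \o f) ->
    mu.-integrable setT (EFin \o (fun w' => f w' * c)).
  move=> fi; rewrite (_ : _ \o _ = (fun w' => (f w')%:E * c%:E)%E)//.
  exact: integrableZr.
have iD (f g : Omega -> R) : mu.-integrable setT (EFin \o f) ->
    mu.-integrable setT (EFin \o g) ->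
    mu.-integrable setT (EFin \o (fun w' => f w' + g w')).
  move=> fi gi; rewrite (_ : _ \o _ = (fun w' => (f w')%:E + (g w')%:E)%E)//.
  exact: integrableD.
have js := iZ _ (s t) is_; have ju := iZ _ (u t) iu; have jv := iZ _ (v t) iv.
rewrite (RintegralD measurableT (iD _ _ js ju) jv) (RintegralD measurableT js ju).
by rewrite (RintegralZr _ measurableT is_) (RintegralZr _ measurableT iu)
  (RintegralZr _ measurableT iv).
Qed.

(** Levels depend on the decisions only through the net flow g - p + z. *)
Lemma eq_level (w0 : 'cV[R]_N.+1) inf inf' (g p z g' p' z' : nat -> 'cV[R]_A) t :
  (forall tau, tau \in hours H d ->
    inf tau = inf' tau /\ g tau - p tau + z tau = g' tau - p' tau + z' tau) ->
  t \in hours H d ->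
  level S d w0 inf g p z t = level S d w0 inf' g' p' z' t.
Proof.
move=> E td; rewrite /level; congr (_ + _); apply: eq_big_nat => tau /andP[t1 t2].
have [|-> ->//] := E tau; rewrite hoursE t1/=.
by apply: leq_trans t2 _; move: td; rewrite hoursE => /andP[].
Qed.

(* Replacing generation by spilling and pumping more while spilling the
   surplus lowers the energy output without affecting any reservoir level. *)
Lemma operation_ok_spill (w0 w1 : 'cV[R]_N.+1) inf inf' (u v lam : nat -> R)
    (g p z : nat -> 'cV[R]_A) :
  (forall t, t \in hours H d -> 0 <= lam t <= 1) ->
  (forall t, t \in hours H d -> inf t = inf' t) ->
  operation_ok S d w0 w1 inf u v g p z ->
  operation_ok S d w0 w1 inf' u v
    (fun t => g t + lam t *: - g t)
    (fun t => p t + lam t *: (p_max S t - p t))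
    (fun t => z t + lam t *: (g t + (p_max S t - p t))).
Proof.
move=> lam01 infE [ok okw1].
have levE t : t \in hours H d -> level S d w0 inf' (fun t => g t + lam t *: - g t)
    (fun t => p t + lam t *: (p_max S t - p t))
    (fun t => z t + lam t *: (g t + (p_max S t - p t))) t =
    level S d w0 inf g p z t.
  move=> td; apply: eq_level => // tau taud; split; first by rewrite infE.
  by apply/matrixP => i j; rewrite !mxE; ring.
split; last by rewrite levE.
move=> t td; have [uv [g0 g1] [p0 p1] z0 lev] := ok t td.
have /andP[l0 l1] := lam01 t td.
rewrite levE//; split => //; first split.
- by move=> i; have := g0 i; rewrite !mxE => gi0; nra.
- by move=> i; have := g0 i; have := g1 i; rewrite !mxE => gi1 gi0; nra.
- split => i; have := p0 i; have := p1 i; rewrite !mxE => pi1 pi0; nra.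
- move=> i; have := p0 i; have := p1 i; have := g0 i; have := z0 i.
  by rewrite !mxE => zi gi pi1 pi0; nra.
Qed.

Definition energy (t : nat) (g p : 'cV[R]_A) : R :=
  dotcv (Defs.eta S t) g - dotcv (zeta S t) p.

(** The lowest output is that of full pumping without generation. *)
Lemma energy_ge t (g p : 'cV[R]_A) : is_hour D H t ->
  lecv 0 g -> lecv p (p_max S t) -> - dotcv (zeta S t) (p_max S t) <= energy t g p.
Proof.
move=> ht g0 pp; rewrite /energy.
have := dotcv_ge0 (eta_ge0 S ht) g0; have := dotcv_le (zeta_ge0 S ht) pp.
lra.
Qed.

(** * From the linear program to adapted decisions *)

Section recourse.
Hypothesis X_ok : uncertainty_axioms D H X.
Variables (s u v : nat -> R) (g p z : nat -> 'cV[R]_A).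
Hypothesis feas : CTr_feasible S X wlev d w s u v g p z.

(* [curtail t] is the fraction of the flexibility between full up-regulation
   and full pumping that the realized activation leaves to be given back;
   when there is no flexibility, division by [0] makes it [0], as it should. *)
Let flex t := energy t (g t) (p t) + dotcv (zeta S t) (p_max S t).
Let curtail t w' :=
  (energy t (g t) (p t) - s t) / flex t
  + (kappa_u X t w' * rho_u X t w') * (- u t / flex t)
  + (kappa_v X t w' * rho_v X t w') * (v t / flex t).

Let curtailE t w' : curtail t w' =
  (energy t (g t) (p t) - (s t + kappa_u X t w' * rho_u X t w' * u t
     - kappa_v X t w' * rho_v X t w' * v t)) / flex t.
Proof. by rewrite /curtail; ring. Qed.

Let curtail_bounds t w' : t \in hours H d -> plausible X t w' ->
  0 <= curtail t w' <= 1 /\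
  curtail t w' * flex t = energy t (g t) (p t)
     - (s t + kappa_u X t w' * rho_u X t w' * u t
        - kappa_v X t w' * rho_v X t w' * v t).
Proof.
move=> td [[/andP[ku0 ku1] _] [/andP[kv0 kv1] _] /andP[ru0 ru1] /andP[rv0 rv1]].
have [[ok _] /(_ t td)[bal vle]] := feas.
have [[u0 v0] [g0 _] [_ p1] _ _] := ok t td.
have ge := energy_ge (hours_is_hour d_day td) g0 p1.
rewrite curtailE.
set y := s t + _ - _; set E := energy t (g t) (p t).
have flexE : flex t = E + dotcv (zeta S t) (p_max S t) by [].
have EE : s t + rho_u_max X t * u t = E by exact: bal.
have kru : kappa_u X t w' * rho_u X t w' <= rho_u_max X t by nra.
have krv : kappa_v X t w' * rho_v X t w' <= rho_v_max X t by nra.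
have kru0 : 0 <= kappa_u X t w' * rho_u X t w' by exact: mulr_ge0.
have krv0 : 0 <= kappa_v X t w' * rho_v X t w' by exact: mulr_ge0.
(* The required output y is largest at full up-regulation without down-regulation, where it equals
   E. *)
have yE : 0 <= E - y by rewrite /y; nra.
(* It is smallest at full down-regulation, where the second constraint of the linear program keeps
   it above full pumping. *)
have yF : E - y <= flex t by rewrite flexE /y; nra.
have [F0|F0] := eqVneq (flex t) 0.
  have -> : E - y = 0 by apply: le_anti; rewrite yE -F0 yF.
  by rewrite !mul0r lexx ler01.
have Fpos : 0 < flex t by rewrite lt0r F0 (le_trans yE).
by rewrite divfK// divr_ge0 ?(ltW Fpos)//= ler_pdivrMr// mul1r yF.
Qed.

Let info_day (t : nat) (Y : Omega -> R) : t \in hours H d ->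
  (kappa_pair X t `|` rho_pair X t) Y ->
  measurable_fun [set: g_sigma_algebraType (info D H X (first_hour H d) t)]
    (Y : g_sigma_algebraType (info D H X (first_hour H d) t) -> R).
Proof.
rewrite inE => /andP[t1 t2] HY; apply: measurable_gen_by.
have dE : d.-1.+1 = d by case: d d_day.
case: HY => HY.
- exists (first_hour H d); first by rewrite /= leqnn.
  left; right; split.
    by split => //; rewrite /day_of /first_hour /= mulnK.
  (* The allocations announced in the first hour cover the H hours of the day, [t] among them. *)
  exists t => //; rewrite t1/= /first_hour addSn subn1/= -mulSnr dE.
  exact: t2.
- exists t; first by rewrite /= t1 leqnn.
  left; left; split; first exact: leq_ltn_trans t1.
  by case: HY => ->; tauto.
Qed.

Let kr_in_L (k r : {RV P >-> R}) (c : R) :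
  {ae P, forall w', 0 <= k w' <= 1 /\ 0 <= r w' <= c} ->
  P.-integrable setT (EFin \o (fun w' => k w' * r w')).
Proof.
move=> box; apply: (@ae_le_integrable _ _ _ P _ (cst c)).
- exact: measurable_funM.
- exact: finite_measure_integrable_cst.
- apply: filterS box => w' [/andP[k0 k1] /andP[r0 rc]].
  by rewrite ger0_norm ?mulr_ge0//= (le_trans _ rc)// ler_piMl.
Qed.

(** The recourse in hour [t] is affine in [curtail t], which involves only the allocations and
    activations of that hour, so it is adapted to the information of the day. *)
Lemma recourse_feasible : exists g' p' z',
  CT_feasible S X wlev d mu s u v g' p' z'.
Proof.
exists (fun t w' => g t + curtail t w' *: - g t),
  (fun t w' => p t + curtail t w' *: (p_max S t - p t)),
  (fun t w' => z t + curtail t w' *: (g t + (p_max S t - p t))).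
split.
  move=> t td.
  have mku := info_day td (or_introl (or_introl erefl)).
  have mkv := info_day td (or_introl (or_intror erefl)).
  have mru := info_day td (or_intror (or_introl erefl)).
  have mrv := info_day td (or_intror (or_intror erefl)).
  have mlam : measurable_fun [set: g_sigma_algebraType (info D H X (first_hour H d) t)]
      (curtail t : g_sigma_algebraType (info D H X (first_hour H d) t) -> R).
    apply: measurable_funD; first apply: measurable_funD => //.
      by apply: measurable_funM => //; exact: measurable_funM.
    by apply: measurable_funM => //; exact: measurable_funM.
  have iu : P.-integrable setT (EFin \o (fun w' => kappa_u X t w' * rho_u X t w')).
    apply: (kr_in_L (c := rho_u_max X t)).
    by apply: filterS (plausible_ae X_ok d_day) => w' /(_ t td)[[? _] _ ? _].
  have iv : P.-integrable setT (EFin \o (fun w' => kappa_v X t w' * rho_v X t w')).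
    apply: (kr_in_L (c := rho_v_max X t)).
    by apply: filterS (plausible_ae X_ok d_day) => w' /(_ t td)[_ [? _] _ ?].
  have ilam : P.-integrable setT (EFin \o curtail t).
    rewrite (_ : EFin \o _ = (fun w' =>
      ((energy t (g t) (p t) - s t) / flex t)%:E
      + (kappa_u X t w' * rho_u X t w')%:E * (- u t / flex t)%:E
      + (kappa_v X t w' * rho_v X t w')%:E * (v t / flex t)%:E)%E)//.
    apply: integrableD => //; last exact: integrableZr.
    apply: integrableD => //; last exact: integrableZr.
    exact: finite_measure_integrable_cst.
  by split; exact: in_L_affine.
apply: filterS2 (good_plausible good) (good_revealed good) => w' pl [wE1 wE2 infE].
have [ok bal] := feas.
split.
  rewrite wE1 wE2; apply: operation_ok_spill ok => t td; last by rewrite infE.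
  by have [] := curtail_bounds td (pl t td).
move=> t td; have [_] := curtail_bounds td (pl t td).
rewrite !dotcvDr !dotcvZr dotcvDr !dotcvNr /flex /energy => E.
by lra.
Qed.

End recourse.

(** * From adapted decisions to the linear program *)

Section worst_case.
Variables (s u v : nat -> R) (g p z : nat -> Omega -> 'cV[R]_A).
Hypothesis feas : CT_feasible S X wlev d mu s u v g p z.

Let ku_top t := reachable P (kappa_u X t).
Let kv_top t := reachable P (kappa_v X t).

(** The constraints are restated with the levels and inflows of the reference outcome [w], which
    almost all outcomes share. *)
Let good_ae : {ae mu, forall w',
  [/\ operation_ok S d (wlev d.-1 w) (wlev d w) (fun t => inflow X t w) u v
        (fun t => g t w') (fun t => p t w') (fun t => z t w'),
      forall t, t \in hours H d ->
        s t + kappa_u X t w' * rho_u X t w' * u t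
            - kappa_v X t w' * rho_v X t w' * v t = energy t (g t w') (p t w') &
      forall t, t \in hours H d -> plausible X t w']}.
Proof.
have [_ feas'] := feas.
apply: filterS3 feas' (good_plausible good) (good_revealed good).
move=> w' [[ok okw1] bal] pl [wE1 wE2 infE]; split => //.
have levE t : t \in hours H d ->
    level S d (wlev d.-1 w) (fun t => inflow X t w) (fun t => g t w')
      (fun t => p t w') (fun t => z t w') t =
    level S d (wlev d.-1 w') (fun t => inflow X t w') (fun t => g t w')
      (fun t => p t w') (fun t => z t w') t.
  by move=> td; rewrite wE1; apply: eq_level => // tau taud; rewrite infE.
split; last by rewrite levE// -wE2.
by move=> t td; have := ok t td; rewrite levE.
Qed.

(** On a nearly full down-regulation day the output, which full pumping bounds below, differs from
    the right-hand side by at most a multiple of [e]. The bids do not depend on the outcome, so [e]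
    may tend to 0. *)
Lemma down_regulation_bound t : t \in hours H d ->
  - dotcv (zeta S t) (p_max S t) <= s t - rho_v_max X t * (kv_top t * v t).
Proof.
move=> td; apply: (@le_of_harmonic _ _ _
  (rho_u_max X t * u t + kv_top t * rho_v_max X t * v t)) => n.
have [w' dw' [[ok _] bal pl]] := good_down good n good_ae.
move: dw' => /(_ t td); set e : R := n.+1%:R^-1.
rewrite /= !in_itv/= andbT => -[kvE [ruE rvE]].
have e0 : 0 < e by rewrite invr_gt0.
have [[u0 v0] [g0 _] [_ p1] _ _] := ok t td.
have := energy_ge (hours_is_hour d_day td) g0 p1; rewrite -bal//.
have [[/andP[ku0 ku1] _] _ /andP[ru0 _] _] := pl t td.
rewrite kvE -/(kv_top t) => h; apply: (le_trans h).
have /andP[kt0 kt1] := reachable01 P (kappa_v X t).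
have h1 : kappa_u X t w' * rho_u X t w' * u t <= e * (rho_u_max X t * u t).
  rewrite mulrA ler_wpM2r//; apply: le_trans (ltW ruE).
  exact: ler_piMl.
have h2 : (1 - e) * rho_v_max X t * (kv_top t * v t) <= rho_v X t w' * (kv_top t * v t).
  by rewrite ler_wpM2r ?mulr_ge0// ltW.
lra.
Qed.

(** Bounds the loss in objective value per unit of [e]. *)
Let slack : R := \sum_(first_hour H d <= t < (last_hour H d).+1)
  (`|pi_s_tilde X mu t| * (rho_v_max X t * v t)
   + `|pi_u_tilde X mu t| * u t + `|pi_v_tilde X mu t| * v t).

Lemma up_regulation_scenario (n : nat) : exists s' u' v' g' p' z',
  CTr_feasible S X wlev d w s' u' v' g' p' z' /\
  CTr_objective (H := H) X d mu s u v <=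
  CTr_objective (H := H) X d mu s' u' v' + n.+1%:R^-1 * slack.
Proof.
have [w' uw' [[ok okw1] bal pl]] := good_up good n good_ae.
set e : R := n.+1%:R^-1; have e0 : 0 < e by rewrite invr_gt0.
(* The shares of the maximal up- and down-activation realized at the chosen outcome; the latter
   includes the allocation. *)
pose a t := rho_u X t w' / rho_u_max X t.
pose b t := kappa_v X t w' * rho_v X t w' / rho_v_max X t.
have facts t : t \in hours H d ->
  [/\ 0 < rho_u_max X t, 0 < rho_v_max X t, 1 - e <= a t <= 1, 0 <= a t
      & 0 <= b t <= e] /\
  [/\ b t <= 1, kappa_u X t w' = ku_top t & kappa_v X t w' * kv_top t = kappa_v X t w'].
  move=> td; have := uw' t td; rewrite -/e /= !in_itv/= andbT.
  move=> [kuE [ruE rvE]].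
  have [_ [/andP[kv0 kv1] kvE] /andP[ru0 ru1] /andP[rv0 rv1]] := pl t td.
  (* Both maxima are positive because the scenario inequalities are strict. *)
  have um : 0 < rho_u_max X t by nra.
  have vm : 0 < rho_v_max X t by nra.
  have krv : kappa_v X t w' * rho_v X t w' <= rho_v X t w' by exact: ler_piMl.
  split; [split => //|split => //].
  - by rewrite /a ler_pdivlMr// ler_pdivrMr// mul1r ru1 (ltW ruE).
  - by rewrite /a divr_ge0// ltW.
  - rewrite /b divr_ge0 ?mulr_ge0 ?(ltW vm)//= ler_pdivrMr//.
    exact: le_trans krv (ltW rvE).
  - rewrite /b ler_pdivrMr// mul1r; exact: le_trans rv1.
(* The spot bid absorbs the realized down-regulation, the factor a turns full activation of the new
   up-bid into the realized one, and the factor 1 - b offsets the change of spot bid in the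
   down-regulation constraint. Bids on unreachable reserves become 0. *)
exists (fun t => s t - kappa_v X t w' * rho_v X t w' * v t),
  (fun t => ku_top t * u t * a t), (fun t => kv_top t * v t * (1 - b t)),
  (fun t => g t w'), (fun t => p t w'), (fun t => z t w').
split; first split; first split => //.
- move=> t td; have [uv ? ? ? ?] := ok t td; split => //.
  have [[_ _ _ a0 _] [b1 _ _]] := facts t td; have [u0 v0] := uv.
  have /andP[ku0 _] := reachable01 P (kappa_u X t).
  have /andP[kv0 _] := reachable01 P (kappa_v X t).
  by split; apply: mulr_ge0; rewrite ?subr_ge0//; exact: mulr_ge0.
- move=> t td.
  have [[um vm _ _ _] [_ kuE kvE]] := facts t td.
  split.
    rewrite -/(energy t (g t w') (p t w')) -bal// -kuE /a.
    have [[_ kuI] _ _ _] := pl t td.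
    by field; rewrite gt_eqF.
  rewrite (_ : _ - _ = s t - rho_v_max X t * (kv_top t * v t)).
    exact: down_regulation_bound.
  rewrite (_ : rho_v_max X t * (kv_top t * v t * (1 - b t)) =
      rho_v_max X t * (kv_top t * v t) -
      kappa_v X t w' * kv_top t * rho_v X t w' * v t).
    by rewrite kvE; ring.
  by rewrite /b; field; rewrite gt_eqF.
- rewrite /CTr_objective /slack mulr_sumr -big_split/=.
  apply: ler_sum_nat => t; rewrite -hoursE => td.
  have [[um vm /andP[a1 a2] _ /andP[b0 be]] _] := facts t td.
  have [[u0 v0] _ _ _ _] := ok t td.
  have [ruE rvE] := good_reachable good td.
  set ps := pi_s_tilde X mu t; set pu := pi_u_tilde X mu t.
  set pv := pi_v_tilde X mu t.
  (* The expected price of an unreachable reserve is 0, so dropping that bid costs nothing. *)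
  have -> : pu * (ku_top t * u t * a t) = pu * (u t * a t).
    by rewrite -[in RHS](ruE : pu * ku_top t = pu); ring.
  have -> : pv * (kv_top t * v t * (1 - b t)) = pv * (v t * (1 - b t)).
    by rewrite -[in RHS](rvE : pv * kv_top t = pv); ring.
  have -> : kappa_v X t w' * rho_v X t w' = b t * rho_v_max X t.
    by rewrite /b divfK// gt_eqF.
  (* Prices may have either sign, hence the absolute value. *)
  have bnd (c x y : R) : 0 <= x <= e * y -> c * x <= e * (`|c| * y).
    move=> /andP[x0 xy]; apply: (le_trans (ler_wpM2r x0 (ler_norm c))).
    by rewrite mulrCA ler_wpM2l.
  have hs : ps * (b t * rho_v_max X t * v t) <= e * (`|ps| * (rho_v_max X t * v t)).
    have rv0 : 0 <= rho_v_max X t * v t by rewrite mulr_ge0// ltW.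
    by apply: bnd; rewrite -mulrA mulr_ge0//= ler_wpM2r.
  have hu : pu * (u t * (1 - a t)) <= e * (`|pu| * u t).
    have a3 : 1 - a t <= e by lra.
    by apply: bnd; rewrite mulr_ge0 ?subr_ge0//= mulrC ler_wpM2r.
  have hv : pv * (v t * b t) <= e * (`|pv| * v t).
    by apply: bnd; rewrite mulr_ge0//= mulrC ler_wpM2r.
  lra.
Qed.

End worst_case.

(** * Comparison of the optimal values *)

Lemma CTr_le_CT (X_ok : uncertainty_axioms D H X) :
  (CTr_value S X wlev d mu w <= CT_value S X wlev d mu)%E.
Proof.
apply: ub_ereal_sup => _ [s [u [v [g [p [z [feas ->]]]]]]].
have [g' [p' [z' feas']]] := recourse_feasible X_ok feas.
apply: ereal_sup_ubound; exists s, u, v, g', p', z'; split => //.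
by rewrite CT_objectiveE.
Qed.

Lemma CT_le_CTr : (CT_value S X wlev d mu <= CTr_value S X wlev d mu w)%E.
Proof.
apply: ub_ereal_sup => _ [s [u [v [g [p [z [feas ->]]]]]]].
rewrite CT_objectiveE.
(* The constant must not depend on [n]; unification with [up_regulation_scenario] supplies the slack
   of the given solution. *)
have [c hc] : exists c, forall n, exists r : R,
    (r%:E <= CTr_value S X wlev d mu w)%E /\
    CTr_objective (H := H) X d mu s u v <= r + n.+1%:R^-1 * c.
  eexists => n.
  have [s' [u' [v' [g' [p' [z' [feas' le]]]]]]] := up_regulation_scenario feas n.
  exists (CTr_objective (H := H) X d mu s' u' v'); split; last exact: le.
  by apply: ereal_sup_ubound; exists s', u', v', g', p', z'.
(* Only a finite value needs the limit; the value -oo is excluded since the scenario yields a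
   feasible point. *)
case: (CTr_value S X wlev d mu w) hc => [r| |] hc.
- rewrite lee_fin; apply: (@le_of_harmonic _ _ _ c) => n.
  by have [r' [r'r le]] := hc n; rewrite lee_fin in r'r;
    apply: (le_trans le); rewrite lerD2r.
- exact: leey.
- by have [r' [+ _]] := hc 0%N; rewrite leeNy_eq.
Qed.

End trader_problem.

Theorem theorem1 (R : realType) (dO : measure_display)
    (Omega : measurableType dO) (P : probability Omega R)
    (N A D H : nat) (H_gt0 : (0 < H)%N)
    (S : reservoir_system R N A D H)
    (X : random_data P N) (X_ok : uncertainty_axioms D H X)
    (w0 : 'cV[R]_N.+1) (wlev : nat -> Omega -> 'cV[R]_N.+1)
    (wlev0 : forall w, wlev 0%N w = w0)
    (wlev_ahead : forall d', is_day D d' ->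
       in_L P (info D H X 0 (eve H d')) (wlev d'))
    (d : nat) (d_day : is_day D d)
    (K : R.-pker (g_sigma_algebraType (info D H X 0 (eve H d))) ~> Omega)
    (K_cond : is_regular_conditional P K) :
  {ae P, forall w : Omega,
    CT_value S X wlev d (K w) = CTr_value S X wlev d (K w) w}.
Proof.
have := good_outcome_ae X_ok H_gt0 wlev0 wlev_ahead d_day K_cond.
apply: filterS => w good; apply: le_anti; apply/andP; split.
  exact: CT_le_CTr good H_gt0 d_day.
exact: CTr_le_CT good H_gt0 d_day X_ok.
Qed.
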